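(* Let $r,\ell \ge 1$ be integers. If $M$ is a simple rank-$r$ positroid with no $U_{2,\ell+2}$-minor, then $|M| \le \ell(r-1)+1$. Moreover, if $r \ge 2$, then equality $|M| = \ell(r-1)+1$ holds if and only if $M$ can be obtained by taking parallel connections of copies of $U_{2,\ell+1}$, i.e. $M$ belongs to the smallest class of matroids that contains every matroid isomorphic to $U_{2,\ell+1}$ and is closed under forming parallel connections $P_e(M_1,M_2)$ of two members $M_1,M_2$ of the class with $E(M_1)\cap E(M_2)=\{e\}$.
   Context: A positroid is a matroid that can be represented (as the column matroid) by a full-rank real matrix all of whose maximal square subdeterminants are nonnegative. $|M|$ denotes the number of elements of the ground set of $M$. $U_{2,n}$ is the rank-$2$ uniform matroid on $n$ elements. A minor is a matroid obtained by a sequence of deletions and contractions (up to isomorphism). Given matroids $M_1, M_2$ with $E(M_1)\cap E(M_2)=\{e\}$, the parallel connection $P_e(M_1,M_2)$ is the matroid on $E(M_1)\cup E(M_2)$ whose flats are exactly the sets $F \subseteq E(M_1)\cup E(M_2)$ such that $F\cap E(M_1)$ is a flat of $M_1$ and $F \cap E(M_2)$ is a flat of $M_2$. *)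

(* Defs.v *)
From HB Require Import structures.
From mathcomp Require Import all_boot all_order all_algebra.
From mathcomp Require Import reals.

Set Implicit Arguments.
Unset Strict Implicit.
Unset Printing Implicit Defensive.

Import Order.TTheory GRing.Theory Num.Theory.

(* A matroid is given by a ground set inside an ambient finite type together   *)
(* with its family of independent sets; the ambient type plays no other role.  *)
Record matroid (T : finType) := Matroid {
  ground : {set T};
  indep : {set {set T}};
  indep_ground : forall I, I \in indep -> I \subset ground;
  indep0 : set0 \in indep;
  indepS : forall I J : {set T}, J \in indep -> I \subset J -> I \in indep;
  indep_aug : forall I J : {set T}, I \in indep -> J \in indep -> #|I| < #|J| ->
    exists2 x, x \in J :\: I & x |: I \in indep
}.

Section Basics.
Variables (T : finType) (M : matroid T).
Implicit Types (X I F : {set T}) (x y : T).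

Definition rank_of X : nat := \max_(I in indep M | I \subset X) #|I|.

Definition matroid_rank : nat := rank_of (ground M).

Definition matroid_closure X : {set T} :=
  [set x in ground M | rank_of (x |: X) == rank_of X].

Definition flat F : bool := (F \subset ground M) && (matroid_closure F == F).

Definition loop x : bool := (x \in ground M) && ([set x] \notin indep M).

Definition parallel x y : bool :=
  [&& x \in ground M, y \in ground M, ~~ loop x, ~~ loop y, x != y
    & [set x; y] \notin indep M].

Definition simple_matroid : Prop :=
  (forall x, ~~ loop x) /\ (forall x y, ~~ parallel x y).

Lemma indep_le_rank X I : I \in indep M -> I \subset X -> #|I| <= rank_of X.
Proof. by move=> iI sIX; rewrite /rank_of (bigD1 I) ?iI //= leq_maxl. Qed.

Lemma rank_of_le X n :
  (forall I, I \in indep M -> I \subset X -> #|I| <= n) -> rank_of X <= n.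
Proof. by move=> h; apply/bigmax_leqP => I /andP[]; apply: h. Qed.

Lemma rank_of_card X : rank_of X <= #|X|.
Proof. by apply: rank_of_le => I _; apply: subset_leq_card. Qed.

Lemma indep_extend X I : I \in indep M -> I \subset X ->
  exists B : {set T}, [/\ B \in indep M, I \subset B, B \subset X & #|B| = rank_of X].
Proof.
move=> iI sIX.
pose P := [pred B : {set T} | (B \in indep M) && (B \subset X)].
have PI : P I by rewrite /= iI.
have [B /maxsetP[/andP[iB sBX] maxB] sIB] := maxset_exists PI.
exists B; split=> //; apply/eqP; rewrite eqn_leq indep_le_rank //=.
apply: rank_of_le => J iJ sJX; rewrite leqNgt; apply/negP => ltBJ.
have [x /setDP[xJ xnB] ixB] := indep_aug iB iJ ltBJ.
have := maxB (x |: B); rewrite /= ixB subUset sub1set (subsetP sJX) // sBX.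
rewrite subsetUr => /(_ isT isT) eqB.
by move: xnB; rewrite -eqB setU11.
Qed.

Lemma rank_ofU X Y : rank_of (X :|: Y) <= #|X| + rank_of Y.
Proof.
apply: rank_of_le => I iI sI.
rewrite -(cardsID X I) leq_add ?subset_leq_card ?subsetIr //.
apply: indep_le_rank; first exact: indepS iI (subsetDl _ _).
by apply/subsetP => x /setDP[/(subsetP sI)/setUP[->|//]].
Qed.

End Basics.

Section Minors.
Variable T : finType.
Implicit Types (M N : matroid T) (C D I J : {set T}).

Section Delete.
Variables (M : matroid T) (D : {set T}).

Definition delete_indep := [set I in indep M | [disjoint I & D]].

Fact delete_ground I : I \in delete_indep -> I \subset ground M :\: D.
Proof. by rewrite inE subsetD => /andP[/indep_ground-> ->]. Qed.

Fact delete_indep0 : set0 \in delete_indep.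
Proof. by rewrite inE indep0 -setI_eq0 set0I eqxx. Qed.

Fact delete_indepS I J : J \in delete_indep -> I \subset J -> I \in delete_indep.
Proof.
rewrite !inE => /andP[iJ dJ] sIJ.
by rewrite (indepS iJ sIJ) (disjointWl sIJ dJ).
Qed.

Fact delete_aug I J : I \in delete_indep -> J \in delete_indep -> #|I| < #|J| ->
  exists2 x, x \in J :\: I & x |: I \in delete_indep.
Proof.
rewrite !inE => /andP[iI dI] /andP[iJ dJ] lt.
have [x xJI ixI] := indep_aug iI iJ lt; exists x => //.
rewrite inE ixI disjoints_subset subUset sub1set -disjoints_subset dI inE andbT.
by have /setDP[xJ _] := xJI; rewrite (disjointFr dJ xJ).
Qed.

Definition delete : matroid T :=
  Matroid delete_ground delete_indep0 delete_indepS delete_aug.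
End Delete.

Section Contract.
Variables (M : matroid T) (C : {set T}).

(* r_{M/C}(I) = r(I u C) - r(C), written without truncated subtraction.       *)
Definition contract_indep :=
  [set I : {set T} | (I \subset ground M :\: C)
                  && (rank_of M (I :|: C) == #|I| + rank_of M C)].

Fact contract_ground I : I \in contract_indep -> I \subset ground M :\: C.
Proof. by rewrite inE => /andP[]. Qed.

Fact contract_indep0 : set0 \in contract_indep.
Proof. by rewrite inE sub0set set0U cards0 eqxx. Qed.

Lemma contract_indepP (B : {set T}) : B \in indep M -> B \subset C ->
    #|B| = rank_of M C ->
  forall I, (I \in contract_indep) = (I \subset ground M :\: C) && (I :|: B \in indep M).
Proof.
move=> iB sBC cB I; rewrite inE; case sI: (I \subset _) => //=.
have [_ dIC] : I \subset ground M /\ [disjoint I & C].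
  by move: sI; rewrite subsetD => /andP[].
have dIB : I :&: B = set0.
  by apply/eqP; rewrite setI_eq0; apply: disjointWr dIC.
have cIB : #|I :|: B| = #|I| + rank_of M C by rewrite cardsU dIB cards0 subn0 cB.
apply/eqP/idP => [rk|iIB].
  have [B' [iB' sBB' sB' cB']] := indep_extend iB (subset_trans sBC (subsetUr I C)).
  suff sub : B' \subset I :|: B.
    by have /eqP<- // : B' == I :|: B by rewrite eqEcard sub cIB cB' rk /=.
  apply/subsetP => x xB'; rewrite inE.
  have /setUP[->//|xC] := subsetP sB' _ xB'.
  apply/orP; right; apply/negPn/negP => xnB.
  have ixB : x |: B \in indep M.
    by apply: indepS iB' _; rewrite subUset sub1set xB'.
  have := indep_le_rank (X := C) ixB; rewrite subUset sub1set xC sBC => /(_ isT).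
  by rewrite cardsU1 xnB cB add1n ltnn.
apply/eqP; rewrite eqn_leq rank_ofU -cIB.
by apply: indep_le_rank => //; apply: setUS.
Qed.

Fact contract_indepS I J : J \in contract_indep -> I \subset J -> I \in contract_indep.
Proof.
have [B [iB _ sBC cB]] := indep_extend (indep0 M) (sub0set C).
rewrite !(contract_indepP iB sBC cB) => /andP[sJ iJB] sIJ.
by rewrite (subset_trans sIJ sJ) (indepS iJB) // setSU.
Qed.

Fact contract_aug I J : I \in contract_indep -> J \in contract_indep ->
  #|I| < #|J| -> exists2 x, x \in J :\: I & x |: I \in contract_indep.
Proof.
have [B [iB _ sBC cB]] := indep_extend (indep0 M) (sub0set C).
rewrite !(contract_indepP iB sBC cB) => /andP[sI iIB] /andP[sJ iJB] lt.
have dB (K : {set T}) : K \subset ground M :\: C -> #|K :|: B| = #|K| + #|B|.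
  rewrite subsetD => /andP[_ dK]; rewrite cardsU.
  have /eqP-> : K :&: B == set0 by rewrite setI_eq0; apply: disjointWr dK.
  by rewrite cards0 subn0.
have lt' : #|I :|: B| < #|J :|: B| by rewrite !dB // ltn_add2r.
have [x /setDP[]] := indep_aug iIB iJB lt'.
rewrite !inE negb_or => /orP[xJ|->]; last by rewrite andbF.
move=> /andP[xnI _] ix; exists x; first by rewrite inE xnI.
by rewrite (contract_indepP iB sBC cB) -setUA ix subUset sub1set (subsetP sJ) ?sI.
Qed.

Definition contract : matroid T :=
  Matroid contract_ground contract_indep0 contract_indepS contract_aug.
End Contract.

Inductive minor M : matroid T -> Prop :=
| minor_refl : minor M M
| minor_delete N D : minor M N -> minor M (delete N D)
| minor_contract N C : minor M N -> minor M (contract N C).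

End Minors.

Definition matroid_iso (T1 T2 : finType) (M1 : matroid T1) (M2 : matroid T2) : Prop :=
  exists f : {x : T1 | x \in ground M1} -> {x : T2 | x \in ground M2},
    bijective f /\
    forall X : {set {x : T1 | x \in ground M1}},
      (val @: X \in indep M1) = (val @: (f @: X) \in indep M2).

Definition has_minor (T1 T2 : finType) (M : matroid T1) (N : matroid T2) : Prop :=
  exists2 M' : matroid T1, minor M M' & matroid_iso M' N.

Section Uniform.
Variables k n : nat.

Definition uniform_indep := [set I : {set 'I_n} | #|I| <= k].

Fact uniform_ground I : I \in uniform_indep -> I \subset [set: 'I_n].
Proof. by rewrite subsetT. Qed.

Fact uniform_indep0 : set0 \in uniform_indep.
Proof. by rewrite inE cards0. Qed.

Fact uniform_indepS (I J : {set 'I_n}) :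
  J \in uniform_indep -> I \subset J -> I \in uniform_indep.
Proof. by rewrite !inE => cJ /subset_leq_card/leq_trans->. Qed.

Fact uniform_aug (I J : {set 'I_n}) :
  I \in uniform_indep -> J \in uniform_indep -> #|I| < #|J| ->
  exists2 x, x \in J :\: I & x |: I \in uniform_indep.
Proof.
rewrite !inE => _ cJ lt.
have /subsetPn[x xJ xnI] : ~~ (J \subset I).
  by apply: contraL lt => /subset_leq_card; rewrite -leqNgt.
by exists x; rewrite !inE ?xnI // cardsU1 xnI (leq_trans lt).
Qed.

Definition uniform : matroid 'I_n :=
  Matroid uniform_ground uniform_indep0 uniform_indepS uniform_aug.
End Uniform.

Section ColumnMatroid.
Variables (F : fieldType) (k n : nat) (A : 'M[F]_(k, n)).

Definition column_indep := [set I : {set 'I_n} | free [seq col j A | j <- enum I]].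

Fact column_ground I : I \in column_indep -> I \subset [set: 'I_n].
Proof. by rewrite subsetT. Qed.

Fact column_indep0 : set0 \in column_indep.
Proof. by rewrite inE enum_set0 nil_free. Qed.

Lemma column_free_U1 (I : {set 'I_n}) (j : 'I_n) : j \notin I ->
  free [seq col i A | i <- enum (j |: I)] = free (col j A :: [seq col i A | i <- enum I]).
Proof.
move=> jI; rewrite -[RHS]/(free [seq col i A | i <- j :: enum I]).
apply/perm_free/perm_map.
apply: uniq_perm; rewrite ?enum_uniq //= ?mem_enum ?jI ?enum_uniq //.
by move=> x; rewrite inE !mem_enum !inE.
Qed.

Fact column_indepS (I J : {set 'I_n}) :
  J \in column_indep -> I \subset J -> I \in column_indep.
Proof.
rewrite !inE => fJ sIJ.
have eqJ : perm_eq (enum J) (enum I ++ enum (J :\: I)).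
  apply: uniq_perm; rewrite ?enum_uniq // ?cat_uniq ?enum_uniq ?andbT /=.
    by apply/hasPn => x; rewrite !mem_enum => /setDP[].
  move=> x; rewrite mem_cat !mem_enum !inE.
  by case xI: (x \in I) => //=; rewrite (subsetP sIJ).
move: fJ; rewrite (perm_free (perm_map _ eqJ)) map_cat.
by apply: catl_free.
Qed.

Fact column_aug (I J : {set 'I_n}) :
  I \in column_indep -> J \in column_indep -> #|I| < #|J| ->
  exists2 x, x \in J :\: I & x |: I \in column_indep.
Proof.
rewrite !inE => fI fJ lt.
case: (boolP [exists x in J, col x A \notin <<[seq col j A | j <- enum I]>>%VS]).
  case/exists_inP => x xJ xsp.
  have xI : x \notin I.
    by apply: contra xsp => xI; apply/memv_span/mapP; exists x; rewrite ?mem_enum.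
  by exists x; rewrite !inE ?xI // column_free_U1 // free_cons xsp.
rewrite negb_exists_in => /forall_inP sp.
suff : #|J| <= #|I| by rewrite leqNgt lt.
move: fI fJ; rewrite /free !size_map -!cardE => /eqP<- /eqP<-.
apply/dimvS/span_subvP => v /mapP[x]; rewrite mem_enum => xJ ->.
by apply/negPn; apply: sp.
Qed.

Definition column_matroid : matroid 'I_n :=
  Matroid column_ground column_indep0 column_indepS column_aug.
End ColumnMatroid.

(* The columns of A carry the linear order of 'I_n, which matters for the      *)
(* signs of the minors; M is a positroid when its ground set can be labelled   *)
(* by the columns of some such A.                                              *)
Definition positroid (R : realType) (T : finType) (M : matroid T) : Prop :=
  exists (k n : nat) (A : 'M[R]_(k, n)),
    [/\ \rank A = k,
        forall f : 'I_k -> 'I_n, (forall i j : 'I_k, i < j -> f i < f j) ->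
          (0 <= \det (colsub f A))%R
      & matroid_iso M (column_matroid A)].

(* M is P_e(M1, M2); a matroid is determined by its ground set and its flats.  *)
Definition is_parallel_connection (T : finType) (e : T) (M1 M2 M : matroid T) : Prop :=
  [/\ ground M1 :&: ground M2 = [set e],
      ground M = ground M1 :|: ground M2
    & forall F : {set T},
        flat M F = [&& F \subset ground M1 :|: ground M2,
                       flat M1 (F :&: ground M1) & flat M2 (F :&: ground M2)]].

(* The smallest class of matroids containing all copies of N and closed under  *)
(* parallel connections. Working inside one ambient type T loses nothing:      *)
(* the ground sets of M1 and M2 are contained in that of P_e(M1, M2).          *)
Inductive parallel_connections_of (T0 : finType) (N : matroid T0) (T : finType) :
  matroid T -> Prop :=
| PC_copy M : matroid_iso M N -> parallel_connections_of N M
| PC_connect e M1 M2 M :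
    parallel_connections_of N M1 -> parallel_connections_of N M2 ->
    is_parallel_connection e M1 M2 M -> parallel_connections_of N M.

(* Main.v *)
Require Import Defs.
From mathcomp Require Import all_boot all_order all_algebra.
From mathcomp Require Import reals.
From mathcomp Require Import perm zify ring.

(* Order the elements by the columns of a totally nonnegative representation. If [c] is
   collinear with [a] and [b], and [p], [q] lie in a plane with them, then a three-term
   Pluecker relation and the signs of the maximal minors show that the chords [ab] and
   [pq] do not cross on the circle; this persists in contractions. Hence the middle point
   [e] of a collinear triple of minimal span lies on at most one line with more than two
   points. Contracting [e] and simplifying loses at most [l] elements and one unit of
   rank, which gives the bound by induction.

   In the case of equality, a hyperplane [H] with at most [l] elements outside lifts from
   the simplified contraction. By the bound applied to contractions, every line through
   two points outside [H] meets [H]; as M(K4) violates the noncrossing condition, all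
   points outside [H] lie on one line [K] with a point of [H]. The ranks of [H] and [K]
   add up to one more than that of [M], which forces [M] to be the parallel connection of
   its restrictions to [K] and [H]. Conversely, a parallel connection of [M1] and [M2] has
   rank less than the sum of the ranks of [M1] and [M2], so that parallel connections
   preserve the opposite inequality. *)

Set Implicit Arguments.
Unset Strict Implicit.
Unset Printing Implicit Defensive.

Import Order.TTheory GRing.Theory Num.Theory.

Ltac set_cases :=
  first [apply/setP => ? | apply/subsetP => ?]; rewrite !inE;
  do ?[case: (_ == _) => //=]; do ?[case: (_ \in _) => //=].

(** * Rank and flats *)

Lemma setU1_id (T : finType) (x : T) (X : {set T}) : x \in X -> x |: X = X.
Proof. by move=> xX; apply/setUidPr; rewrite sub1set. Qed.

Section Rank.
Variables (T : finType) (M : matroid T).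
Implicit Types (X Y Z I F : {set T}) (x y z : T).
Local Notation r := (rank_of M).
Local Notation E := (ground M).

Lemma rank_ofS X Y : X \subset Y -> r X <= r Y.
Proof.
by move=> sXY; apply: rank_of_le => I iI sI; apply: indep_le_rank (subset_trans sI sXY).
Qed.

Lemma exists_basis X : exists I, [/\ I \in indep M, I \subset X & #|I| = r X].
Proof.
by have [B [iB _ sB cB]] := indep_extend (indep0 M) (sub0set X); exists B.
Qed.

Lemma rank_of_indep I : I \in indep M -> r I = #|I|.
Proof. by move=> iI; apply/eqP; rewrite eqn_leq rank_of_card indep_le_rank. Qed.

Lemma indepE X : (X \in indep M) = (r X == #|X|).
Proof.
apply/idP/eqP => [|rX]; first exact: rank_of_indep.
have [I [iI sI cI]] := exists_basis X.
by have /eqP<- : I == X by rewrite eqEcard sI cI rX leqnn.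
Qed.

Lemma rank_of0 : r set0 = 0.
Proof. by apply/eqP; rewrite -leqn0 -(cards0 T) rank_of_card. Qed.

Lemma rank_of1_le x : r [set x] <= 1.
Proof. by have := rank_of_card M [set x]; rewrite cards1. Qed.

Lemma rank_of2_le x y : r [set x; y] <= 2.
Proof. by apply: leq_trans (rank_of_card _ _) _; rewrite cards2; case: eqP. Qed.

Lemma rank_of_submod X Y : r (X :|: Y) + r (X :&: Y) <= r X + r Y.
Proof.
have [I [iI sI cI]] := exists_basis (X :&: Y).
have [sIX sIY] := subsetIP sI.
have [J [iJ sIJ sJ cJ]] := indep_extend iI (subset_trans sIX (subsetUl X Y)).
have rankI (Z : {set T}) : #|J :&: Z| <= r Z.
  by apply: indep_le_rank (subsetIr _ _); apply: indepS iJ (subsetIl _ _).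
apply: leq_trans (leq_add (rankI X) (rankI Y)).
rewrite -cardsUI -setIUr (setIidPl sJ) cJ leq_add2l -cI subset_leq_card //.
by rewrite !subsetI sIJ sIX sIY.
Qed.

Lemma rank_ofU_leq X Y : r (X :|: Y) <= r X + r Y.
Proof. exact: leq_trans (leq_addr _ _) (rank_of_submod X Y). Qed.

Lemma rank_ofU1_leq x X : r (x |: X) <= (r X).+1.
Proof. by have := rank_ofU M [set x] X; rewrite cards1. Qed.

Lemma rank_ofU_spanS X Y Z : X \subset Y -> r (Z :|: X) <= r X -> r (Z :|: Y) = r Y.
Proof.
move=> sXY spanX; apply/eqP; rewrite eqn_leq [X in _ && X]rank_ofS ?subsetUr // andbT.
have := rank_of_submod (Z :|: X) Y; rewrite -setUA (setUidPr sXY).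
have : r X <= r ((Z :|: X) :&: Y) by apply: rank_ofS; rewrite subsetI subsetUr.
lia.
Qed.

Lemma rank_ofU_span X Z : (forall z, z \in Z -> r (z |: X) <= r X) -> r (Z :|: X) = r X.
Proof.
have [n leZ] := ubnP #|Z|; elim: n Z leZ => // n IHn Z leZ spanX.
have [->|[z zZ]] := set_0Vmem Z; first by rewrite set0U.
rewrite -(setD1K zZ) -setUA (rank_ofU_spanS (subsetUr (Z :\ z) X) (spanX z zZ)) IHn //.
  by rewrite (cardsD1 z) zZ add1n ltnS in leZ.
by move=> y /setD1P[_ /spanX].
Qed.

Lemma rank_ofU_skew X Y Z :
  r (X :|: Z) = r X + r Z -> r (Y :|: X) = r X -> r (Y :|: Z) = r Y + r Z.
Proof.
move=> skewX spanX; apply/eqP; rewrite eqn_leq rank_ofU_leq /=.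
have := rank_of_submod (Y :|: X) (Y :|: Z); rewrite spanX.
have : r (X :|: Z) <= r ((Y :|: X) :|: (Y :|: Z)) by apply: rank_ofS; set_cases.
have : r Y <= r ((Y :|: X) :&: (Y :|: Z)) by apply: rank_ofS; set_cases.
lia.
Qed.

Lemma flatP F :
  reflect (F \subset E /\ forall x, x \in E -> x \notin F -> r F < r (x |: F)) (flat M F).
Proof.
rewrite /flat; apply: (iffP andP) => [[sF /eqP clF]|[sF ltF]]; split=> //.
  move=> x xE; rewrite -{1}clF inE xE /= => ne.
  by rewrite ltn_neqAle eq_sym ne rank_ofS ?subsetUr.
apply/eqP/setP=> x; rewrite inE; apply/andP/idP => [[xE /eqP eqr]|xF].
  by apply/negPn/negP => /(ltF x xE); rewrite eqr ltnn.
by rewrite (subsetP sF) // setU1_id // eqxx.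
Qed.

Lemma closure_sub_ground X : matroid_closure M X \subset E.
Proof. by apply/subsetP => x /setIdP[]. Qed.

Lemma sub_closure X : X \subset E -> X \subset matroid_closure M X.
Proof.
by move=> sX; apply/subsetP => x xX; rewrite inE (subsetP sX) // setU1_id // eqxx.
Qed.

Lemma rank_closureU X : r (matroid_closure M X :|: X) = r X.
Proof. by apply: rank_ofU_span => z; rewrite inE => /andP[_ /eqP->]. Qed.

Lemma rank_closure X : X \subset E -> r (matroid_closure M X) = r X.
Proof. by move=> sX; rewrite -(setUidPl (sub_closure sX)) rank_closureU. Qed.

Lemma flat_closure X : X \subset E -> flat M (matroid_closure M X).
Proof.
move=> sX; apply/flatP; split=> [|x xE]; first exact: closure_sub_ground.
rewrite inE xE rank_closure //= => ne; apply: leq_trans (_ : r (x |: X) <= _).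
  by rewrite ltn_neqAle eq_sym ne rank_ofS ?subsetUr.
by rewrite rank_ofS // setUS // sub_closure.
Qed.

Lemma flat_spanning F : flat M F -> matroid_rank M <= r F -> F = E.
Proof.
move=> /flatP[sF ltF] rF; apply/eqP; rewrite eqEsubset sF /=.
apply/subsetP => x xE; apply/negPn/negP => /(ltF x xE).
by rewrite ltnNge (leq_trans _ rF) // rank_ofS // subUset sub1set xE.
Qed.

Lemma simple_matroidP : simple_matroid M <->
  (forall x, x \in E -> r [set x] = 1) /\
  (forall x y, x \in E -> y \in E -> x != y -> r [set x; y] = 2).
Proof.
split=> [[noloop noparallel]|[rank1 rank2]].
  have indep1 x : x \in E -> [set x] \in indep M.
    by move=> xE; have := noloop x; rewrite /loop xE /= => /negPn.
  split=> [x xE|x y xE yE ne]; first by rewrite rank_of_indep ?indep1 // cards1.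
  have := noparallel x y; rewrite /parallel /loop xE yE ne !indep1 //=.
  by move=> /negPn/rank_of_indep->; rewrite cards2 ne.
split=> [x|x y].
  by rewrite /loop; case xE: (x \in _); rewrite //= negbK indepE rank1 // cards1.
rewrite /parallel; case xE: (x \in _) => //=; case yE: (y \in _) => //=.
rewrite !negb_and; case: eqP => [|/eqP ne]; first by rewrite !orbT.
by rewrite (indepE [set x; y]) rank2 // cards2 ne eqxx !orbT.
Qed.

End Rank.

(** * Minors *)

Section MinorRank.
Variables (T : finType) (M : matroid T).
Implicit Types (C D F I X Y : {set T}) (x y : T).
Local Notation E := (ground M).

Lemma rank_of_delete D X : X \subset ground (delete M D) ->
  rank_of (delete M D) X = rank_of M X.
Proof.
rewrite /= subsetD => /andP[_ dX]; apply/eqP.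
rewrite eqn_leq; apply/andP; split; apply: rank_of_le => I iI sI.
  by move: iI; rewrite inE => /andP[iI _]; apply: indep_le_rank.
by apply: indep_le_rank; rewrite // inE iI (disjointWl sI dX).
Qed.

Lemma rank_of_contract C X :
  rank_of (contract M C) X + rank_of M C = rank_of M (X :|: C).
Proof.
have [B [iB sB cB]] := exists_basis M C.
apply/eqP; rewrite eqn_leq; apply/andP; split.
  have [I [iI sI cI]] := exists_basis (contract M C) X; rewrite -cI.
  by move: iI; rewrite inE => /andP[_ /eqP<-]; apply: rank_ofS; rewrite setSU.
have [J [iJ sBJ sJ cJ]] := indep_extend iB (subset_trans sB (subsetUr X C)).
have JB_C x : x \in J :\: B -> x \notin C.
  case/setDP=> xJ xB; apply/negP => xC.
  have ixB : x |: B \in indep M by apply: indepS iJ _; rewrite subUset sub1set xJ.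
  have := indep_le_rank (X := C) ixB; rewrite subUset sub1set xC sB => /(_ isT).
  by rewrite cardsU1 xB cB add1n ltnn.
rewrite -cJ -cB -(cardsID B J) (setIidPr sBJ) addnC leq_add2r.
apply: indep_le_rank; last first.
  apply/subsetP => x xJB; have /setDP[/(subsetP sJ)/setUP[//|xC] _] := xJB.
  by have := JB_C x xJB; rewrite xC.
rewrite (contract_indepP iB sB cB); apply/andP; split.
  apply/subsetP => x xJB; rewrite inE JB_C //=.
  by case/setDP: xJB => /(subsetP (indep_ground iJ)).
by rewrite -{2}(setIidPr sBJ) setUC setID.
Qed.

Lemma minor_trans (N P : matroid T) : minor M N -> minor N P -> minor M P.
Proof. by move=> mN; elim=> // P' D _; [apply: minor_delete|apply: minor_contract]. Qed.

Definition restrict X : matroid T := delete M (~: X).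

Lemma ground_restrict X : X \subset E -> ground (restrict X) = X.
Proof. by move=> sX; rewrite /= setDE setCK (setIidPr sX). Qed.

Lemma rank_restrict X Y : X \subset E -> Y \subset X ->
  rank_of (restrict X) Y = rank_of M Y.
Proof. by move=> sX sY; rewrite rank_of_delete // ground_restrict. Qed.

Lemma matroid_rank_restrict X : X \subset E -> matroid_rank (restrict X) = rank_of M X.
Proof. by move=> sX; rewrite /matroid_rank ground_restrict // rank_restrict. Qed.

Lemma flat_restrictP X F : X \subset E -> F \subset X ->
  reflect (forall x, x \in X -> x \notin F -> rank_of M F < rank_of M (x |: F))
          (flat (restrict X) F).
Proof.
move=> sX sF; have gX := ground_restrict sX.
have rankU1 x : x \in X -> rank_of (restrict X) (x |: F) = rank_of M (x |: F).
  by move=> xX; rewrite rank_restrict // subUset sub1set xX.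
apply: (iffP (flatP _ _)) => [[_ ltF] x xX xF|ltF].
  by have := ltF x; rewrite gX rankU1 // rank_restrict // => /(_ xX xF).
by split=> [|x]; rewrite gX // => xX xF; rewrite rankU1 // rank_restrict // ltF.
Qed.

Lemma flat_restrict X F : X \subset E -> flat M F -> flat (restrict X) (F :&: X).
Proof.
move=> sX /flatP[sF ltF]; apply/flat_restrictP; rewrite ?subsetIr // => x xX.
rewrite inE xX andbT => xF; rewrite ltnNge; apply/negP => spanFX.
by have := ltF x (subsetP sX _ xX) xF; rewrite (rank_ofU_spanS (subsetIl F X) spanFX) ltnn.
Qed.

Lemma simple_delete D : simple_matroid M -> simple_matroid (delete M D).
Proof.
move=> /simple_matroidP[rank1 rank2]; apply/simple_matroidP; split=> [x xE|x y xE yE ne].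
  by rewrite rank_of_delete ?sub1set // rank1 //; case/setDP: xE.
rewrite rank_of_delete ?subUset ?sub1set ?xE // rank2 //.
  by case/setDP: xE.
by case/setDP: yE.
Qed.

End MinorRank.

Section Isomorphism.
Variables (T1 T2 : finType) (M1 : matroid T1) (M2 : matroid T2).
Implicit Type X : {set T1}.

Definition iso_by (g : T1 -> T2) : Prop :=
  [/\ {in ground M1 &, injective g}, g @: ground M1 = ground M2 &
      forall X, X \subset ground M1 -> (X \in indep M1) = (g @: X \in indep M2)].

Lemma matroid_iso_iso_by x0 : x0 \in ground M1 -> matroid_iso M1 M2 -> exists g, iso_by g.
Proof.
move=> x0E [f [bijf indf]].
pose g x := val (f (insubd (exist _ x0 x0E) x)).
have gE (u : {x : T1 | x \in ground M1}) : g (val u) = val (f u) by rewrite /g valKd.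
exists g; split.
- move=> x y xE yE; rewrite -[x]/(val (exist (fun x => x \in ground M1) x xE)).
  rewrite -[y]/(val (exist (fun x => x \in ground M1) y yE)) !gE.
  by move/val_inj/(bij_inj bijf)->.
- apply/setP => y; apply/imsetP/idP => [[x xE ->]|yE].
    by rewrite -[x]/(val (exist (fun x => x \in ground M1) x xE)) gE; apply: valP.
  have [f' fK f'K] := bijf; exists (val (f' (exist _ y yE))); first exact: valP.
  by rewrite gE f'K.
move=> X sX; pose X' := [set u : {x : T1 | x \in ground M1} | val u \in X].
have -> : X = val @: X'.
  apply/setP => x; apply/idP/imsetP => [xX|[u]]; last by rewrite inE => uX ->.
  by exists (exist _ x (subsetP sX _ xX)); rewrite ?inE.
by rewrite indf -!imset_comp (eq_imset _ gE).
Qed.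

Lemma iso_by_matroid_iso g : iso_by g -> matroid_iso M1 M2.
Proof.
case=> injg img indg.
have gE (u : {x : T1 | x \in ground M1}) : g (val u) \in ground M2.
  by rewrite -img imset_f //; apply: valP.
pose f u : {x : T2 | x \in ground M2} := exist _ (g (val u)) (gE u).
exists f; split.
  apply: inj_card_bij; last by rewrite !card_sig -img card_in_imset.
  by move=> u v /(congr1 val)/= /(injg _ _ (valP u) (valP v))/val_inj.
move=> X; have -> : val @: (f @: X) = g @: (val @: X).
  by rewrite -!imset_comp; apply: eq_imset.
by rewrite indg //; apply/subsetP => x /imsetP[u _ ->]; apply: valP.
Qed.

Lemma iso_by_rank g X : iso_by g -> X \subset ground M1 ->
  rank_of M1 X = rank_of M2 (g @: X).
Proof.
case=> injg img indg sX.
have cardg (Y : {set T1}) : Y \subset ground M1 -> #|g @: Y| = #|Y|.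
  by move=> sY; rewrite card_in_imset //; apply: sub_in2 injg; apply/subsetP.
apply/eqP; rewrite eqn_leq; apply/andP; split; apply: rank_of_le => I iI sI.
  have sIE := subset_trans sI sX.
  by rewrite -cardg //; apply: indep_le_rank; rewrite -?indg // imsetS.
have IE : I = g @: (X :&: g @^-1: I).
  apply/setP => y; apply/idP/imsetP => [yI|[x]]; last by rewrite !inE => /andP[_ xI] ->.
  by have /imsetP[x xX e] := subsetP sI y yI; exists x; rewrite // !inE xX -e.
have sIE : X :&: g @^-1: I \subset ground M1 by apply: subset_trans (subsetIl _ _) sX.
by rewrite IE cardg //; apply: indep_le_rank (subsetIl _ _); rewrite indg // -IE.
Qed.

End Isomorphism.

Section UniformRank2.
Variables (T : finType) (M : matroid T) (n : nat).
Implicit Types X I : {set T}.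
Local Notation E := (ground M).

Lemma simple_iso_uniform2 : simple_matroid M -> matroid_rank M <= 2 ->
  #|E| = n.+1 -> matroid_iso M (uniform 2 n.+1).
Proof.
move=> /simple_matroidP[rank1 rank2] rM cM.
have indep_card X : X \subset E -> (X \in indep M) = (#|X| <= 2).
  move=> sX; apply/idP/idP => [/rank_of_indep<-|].
    by apply: leq_trans rM; apply: rank_ofS.
  rewrite leq_eqVlt => /orP[/cards2P[x [y [ne eqX]]]|].
    move: sX; rewrite eqX subUset !sub1set => /andP[xE yE].
    by rewrite indepE rank2 // cards2 ne.
  rewrite ltnS leq_eqVlt => /orP[/cards1P[x eqX]|].
    by move: sX; rewrite eqX sub1set => xE; rewrite indepE rank1 // cards1.
  by rewrite ltnS leqn0 cards_eq0 => /eqP->; apply: indep0.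
have [x0 x0E] : exists x0, x0 \in E by apply/set0Pn; rewrite -cards_eq0 cM.
pose g x : 'I_n.+1 := cast_ord cM (enum_rank_in x0E x).
have injg : {in E &, injective g}.
  by move=> x y xE yE /cast_ord_inj/(congr1 enum_val); rewrite !enum_rankK_in.
apply: (@iso_by_matroid_iso _ _ _ _ g); split=> //.
  by apply/eqP; rewrite eqEcard subsetT card_in_imset // cM cardsT card_ord /=.
move=> X sX; rewrite indep_card // inE card_in_imset //.
by apply: sub_in2 injg; apply/subsetP.
Qed.

Lemma iso_uniform2 : matroid_iso M (uniform 2 n.+1) ->
  [/\ flat M set0, matroid_rank M <= 2 & #|E| = n.+1].
Proof.
move=> isoM; have [x0 x0E] : exists x0, x0 \in E.
  case: isoM => f [[g _ _] _].
  have oE : ord0 \in ground (uniform 2 n.+1) by rewrite inE.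
  by exists (val (g (exist (fun x => x \in ground (uniform 2 n.+1)) _ oE))); apply: valP.
have [g [injg img indg]] := matroid_iso_iso_by x0E isoM.
have indep_card X : X \subset E -> (X \in indep M) = (#|X| <= 2).
  move=> sX; rewrite indg // inE card_in_imset //.
  by apply: sub_in2 injg; apply/subsetP.
split; last by rewrite -(card_in_imset injg) img cardsT card_ord.
  apply/flatP; split=> [|x xE _]; first exact: sub0set.
  by rewrite setU0 rank_of0 rank_of_indep ?cards1 // indep_card ?cards1 // sub1set.
by apply: rank_of_le => I iI sI; rewrite -indep_card.
Qed.

End UniformRank2.

(** * Minors of matrices and column matroids *)

Section MaximalMinors.
Variables (R : comNzRingType) (k n : nat) (A : 'M[R]_(k, n)).
Implicit Type f : 'I_k -> 'I_n.
Local Open Scope ring_scope.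

Lemma det_colsub_inj f : \det (colsub f A) != 0 -> injective f.
Proof.
move=> detA; apply/injectiveP; apply: contraNT detA => /injectivePn[i [j ne eqf]].
rewrite -det_tr; apply/eqP/(determinant_alternate ne) => c.
by rewrite !mxE eqf.
Qed.

Lemma det_colsub_perm f (s : 'S_k) :
  \det (colsub (f \o s) A) = (-1) ^+ s * \det (colsub f A).
Proof.
have -> : colsub (f \o s) A = colsub f A *m perm_mx s^-1.
  by rewrite -col_permE; apply/matrixP => i j; rewrite !mxE.
by rewrite det_mulmx det_perm odd_permV mulrC.
Qed.

Lemma det_mx33 (B : 'M[R]_3) : \det B =
  B 0 0 * (B 1 1 * B 2 2 - B 1 2 * B 2 1) - B 0 1 * (B 1 0 * B 2 2 - B 1 2 * B 2 0)
  + B 0 2 * (B 1 0 * B 2 1 - B 1 1 * B 2 0).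
Proof.
pose b (i j : nat) := B (inord i) (inord j).
have BE i j : B i j = b i j by rewrite /b !inord_val.
rewrite (expand_det_row _ 0) !big_ord_recl big_ord0 /cofactor.
rewrite !(expand_det_row _ 0) !big_ord_recl !big_ord0 /cofactor !det_mx11 !mxE /=.
by rewrite !BE /= /bump /=; ring.
Qed.

End MaximalMinors.

Section ColumnBases.
Variables (F : fieldType) (k n : nat) (A : 'M[F]_(k, n)).
Implicit Type f : 'I_k -> 'I_n.
Local Open Scope ring_scope.

Lemma det_colsub_indep f : injective f ->
  (\det (colsub f A) != 0) = (f @: [set: 'I_k] \in column_indep A).
Proof.
move=> injf; rewrite inE.
have /(perm_map (fun j => col j A))/perm_free-> :
    perm_eq (enum (f @: [set: 'I_k])) [seq f i | i <- enum 'I_k].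
  apply: uniq_perm => [||j]; [exact: enum_uniq | by rewrite map_inj_uniq ?enum_uniq |].
  rewrite mem_enum; apply/imsetP/mapP => -[i _ ->]; exists i => //.
  by rewrite mem_enum.
rewrite -map_comp; set t := map_tuple ((fun j => col j A) \o f) (ord_tuple k).
have tE (i : 'I_k) : t`_i = col (f i) A by rewrite -tnth_nth tnth_map tnth_ord_tuple.
have sumE (c : 'I_k -> F) : \sum_(i < k) c i *: t`_i = colsub f A *m (\col_i c i).
  apply/colP => j; rewrite summxE mxE; apply: eq_bigr => i _.
  by rewrite tE !mxE mulrC.
rewrite -unitfE -[_ \is a _]/(colsub f A \in unitmx) -[map _ _]/(tval t).
apply/idP/freeP => [unitA c|freeA].
  rewrite sumE => Ac0 i; have : \col_j c j = 0.
    by rewrite -(mulKmx unitA (\col_j c j)) Ac0 mulmx0.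
  by move/colP/(_ i); rewrite !mxE.
rewrite -unitmx_tr -row_free_unit -kermx_eq0; apply/eqP/row_matrixP => i; rewrite row0.
set v := row i _; have vK : v *m (colsub f A)^T = 0 by rewrite /v -row_mul mulmx_ker row0.
apply/rowP => j; rewrite [RHS]mxE; apply: (freeA (fun j => v 0 j)); rewrite sumE.
have -> : \col_i0 v 0 i0 = v^T by apply/colP=> c; rewrite !mxE.
by apply: trmx_inj; rewrite trmx_mul trmxK vK trmx0.
Qed.

Lemma column_rank_le X : (rank_of (column_matroid A) X <= k)%N.
Proof.
apply: rank_of_le => I; rewrite inE /free => /eqP; rewrite size_map -cardE => <- _.
by apply: leq_trans (dimvS (subvf _)) _; rewrite dimvf /dim /= muln1.
Qed.

Lemma det_colsub_neq0 f :
  (\det (colsub f A) != 0) = (rank_of (column_matroid A) (f @: [set: 'I_k]) == k).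
Proof.
apply/idP/eqP => [detA|rankf].
  have injf := det_colsub_inj detA.
  rewrite (@rank_of_indep _ (column_matroid A)) -?(det_colsub_indep injf) //.
  by rewrite card_imset // cardsT card_ord.
have cardf : #|f @: [set: 'I_k]| == #|[set: 'I_k]|.
  rewrite eqn_leq leq_imset_card cardsT card_ord -{1}rankf.
  exact: (rank_of_card (column_matroid A)).
have injf : injective f by move=> i j; apply: (imset_injP cardf); rewrite inE.
rewrite (det_colsub_indep injf) -[column_indep A]/(indep (column_matroid A)).
by rewrite indepE rankf (eqP cardf) cardsT card_ord.
Qed.

Lemma column_matroid_rank : \rank A = k -> matroid_rank (column_matroid A) = k.
Proof.
move=> rankA; have fullA : row_full A^T by rewrite /row_full mxrank_tr rankA.
have : \det (colsub (fullrankfun fullA) A) != 0.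
  rewrite -unitfE -[_ \is a _]/(_ \in unitmx) -unitmx_tr -row_full_unit.
  have -> : (colsub (fullrankfun fullA) A)^T = rowsub (fullrankfun fullA) A^T.
    by apply/matrixP=> i j; rewrite !mxE.
  exact: fullrowsub_full.
rewrite det_colsub_neq0 => /eqP rankf.
apply/eqP; rewrite eqn_leq column_rank_le -{1}rankf.
exact/rank_ofS/subsetT.
Qed.

End ColumnBases.

Lemma exists_increasing_perm (k : nat) (f : 'I_k -> nat) : injective f ->
  exists s : 'S_k, forall i j : 'I_k, i < j -> f (s i) < f (s j).
Proof.
move=> injf; pose t := [tuple f i | i < k].
have /tuple_permP[s sE] : perm_eq (sort leq t) t by rewrite perm_sort.
have incr : sorted ltn (sort leq t).
  rewrite ltn_sorted_uniq_leq sort_sorted ?andbT; last exact: leq_total.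
  by rewrite sort_uniq map_inj_uniq ?enum_uniq.
exists s => i j ij.
have nthE (c : 'I_k) : nth 0 (sort leq t) c = f (s c).
  by rewrite sE -tnth_nth !tnth_mktuple.
rewrite -!nthE; apply: (sorted_ltn_nth ltn_trans _ incr); rewrite ?inE //.
  by rewrite size_sort size_tuple.
by rewrite size_sort size_tuple.
Qed.

Section VandermondeSign.
Variables (R : realFieldType) (k n : nat).
Implicit Types (f : 'I_k -> 'I_n) (A : 'M[R]_(k, n)).
Local Open Scope ring_scope.

Definition nonneg_minors A : Prop := forall f,
  (forall i j : 'I_k, (i < j)%N -> (f i < f j)%N) -> 0 <= \det (colsub f A).

Definition vdm f : R := \det (colsub f (Vandermonde k (\row_(j < n) j%:R))).

Lemma vdmE f : vdm f = \prod_(i < k) \prod_(j < k | (i < j)%N) ((f j)%:R - (f i)%:R).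
Proof.
rewrite /vdm (_ : colsub _ _ = Vandermonde k (\row_j (f j)%:R)); last first.
  by apply/matrixP => i j; rewrite !mxE.
by rewrite det_Vandermonde; apply: eq_bigr => i _; apply: eq_bigr => j _; rewrite !mxE.
Qed.

(* Both factors change by the sign of the permutation that sorts the columns. *)
Lemma det_colsub_vdm_gt0 A f : nonneg_minors A ->
  \det (colsub f A) != 0 -> 0 < \det (colsub f A) * vdm f.
Proof.
move=> Anneg detA; have [s incr] := exists_increasing_perm (inj_comp val_inj (det_colsub_inj detA)).
have -> : \det (colsub f A) * vdm f = \det (colsub (f \o s) A) * vdm (f \o s).
  by rewrite /vdm !det_colsub_perm mulrACA -signr_addb addbb mul1r.
apply: mulr_gt0.
  by rewrite lt0r Anneg // det_colsub_perm mulf_neq0 ?signr_eq0.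
rewrite vdmE; apply: prodr_gt0 => i _; apply: prodr_gt0 => j /incr ltf.
by rewrite subr_gt0 ltr_nat.
Qed.

End VandermondeSign.

Section Bracket.
Variables (m n : nat) (w : 'I_m -> 'I_n).
Implicit Types x y z : 'I_n.

Definition adjoin3 x y z (i : 'I_(3 + m)) : 'I_n :=
  match split i with inl j => tnth [tuple x; y; z] j | inr j => w j end.

Lemma adjoin3_lshift x y z j : adjoin3 x y z (lshift m j) = tnth [tuple x; y; z] j.
Proof. by rewrite /adjoin3 (unsplitK (inl j)). Qed.

Lemma adjoin3_rshift x y z j : adjoin3 x y z (rshift 3 j) = w j.
Proof. by rewrite /adjoin3 (unsplitK (inr j)). Qed.

Lemma adjoin3_image x y z :
  adjoin3 x y z @: [set: 'I_(3 + m)] = [set x; y; z] :|: w @: [set: 'I_m].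
Proof.
apply/setP => u; rewrite [in RHS]inE; apply/imsetP/orP => [[i _ ->]|].
  rewrite -(splitK i); case: (split i) => j /=.
    by rewrite adjoin3_lshift; left; have := mem_tnth j [tuple x; y; z]; rewrite !inE orbA.
  by rewrite adjoin3_rshift; right; rewrite imset_f ?inE.
case=> [xyz|/imsetP[j _ ->]]; last by exists (rshift 3 j); rewrite ?inE ?adjoin3_rshift.
have /tnthP[j ->] : u \in [tuple x; y; z] by move: xyz; rewrite !inE orbA.
by exists (lshift m j); rewrite ?inE ?adjoin3_lshift.
Qed.

Section VandermondeBracket.
Variable R : realFieldType.
Local Open Scope ring_scope.

Lemma vdm_adjoin3 : exists (g : 'I_n -> R) (d : R), forall x y z,
  vdm R (adjoin3 x y z) =
   (y%:R - x%:R) * (z%:R - x%:R) * (z%:R - y%:R) * (g x * g y * g z) * d.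
Proof.
exists (fun x => \prod_(j < m) ((w j)%:R - x%:R)), (vdm R w) => x y z.
rewrite !vdmE big_split_ord /=; congr (_ * _); last first.
  apply: eq_bigr => i _; rewrite big_split_ord /= big_pred0 ?mul1r; last first.
    move=> j; apply/negbTE; rewrite -leqNgt.
    exact: leq_trans (ltnW (ltn_ord j)) (leq_addr _ _).
  by apply: eq_big => [j|j _]; rewrite ?ltn_add2l // !adjoin3_rshift.
pose t := tnth [tuple x; y; z].
have factorsE (i : 'I_3) : \prod_(j < 3 + m | (i < j)%N)
      ((adjoin3 x y z j)%:R - (adjoin3 x y z (lshift m i))%:R : R) =
    \prod_(j < 3 | (i < j)%N) ((t j)%:R - (t i)%:R) * \prod_(j < m) ((w j)%:R - (t i)%:R).
  rewrite big_split_ord /=; congr (_ * _).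
    by apply: eq_bigr => j _; rewrite !adjoin3_lshift.
  apply: eq_big => [j|j _]; last by rewrite adjoin3_lshift adjoin3_rshift.
  by rewrite (leq_trans (ltn_ord i)) ?leq_addr.
rewrite (eq_bigr _ (fun i _ => factorsE i)).
rewrite !big_ord_recl !big_ord0 /= 3!(big_mkcond (fun j : 'I_3 => (_ < j)%N)) /=.
by rewrite !big_ord_recl !big_ord0 /t /=; ring.
Qed.

End VandermondeBracket.

Section PluckerRelation.
Variables (F : fieldType) (A : 'M[F]_(3 + m, n)).
Local Open Scope ring_scope.

Definition bracket x y z : F := \det (colsub (adjoin3 x y z) A).

Lemma colsub_adjoin3 (B : 'M[F]_(3 + m, n)) x y z :
  colsub (adjoin3 x y z) B = row_mx (colsub (tnth [tuple x; y; z]) B) (colsub w B).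
Proof.
apply/matrixP => i j; rewrite -(splitK j) !mxE; case: (split j) => c /=.
  by rewrite adjoin3_lshift (unsplitK (inl c)) mxE.
by rewrite adjoin3_rshift (unsplitK (inr c)) mxE.
Qed.

(* The coordinates in [V] are relative to a basis that extends the columns [w]. *)
Lemma bracket_det3 : exists (d : F) (V : 'M[F]_(3, n)), forall x y z,
  bracket x y z = d * \det (colsub (tnth [tuple x; y; z]) V).
Proof.
have [/existsP[[[a b] c] /= abc]|] := boolP [exists t : 'I_n * 'I_n * 'I_n,
    bracket t.1.1 t.1.2 t.2 != 0]; last first.
  rewrite negb_exists => /forallP br0; exists 0, 0 => x y z.
  by rewrite mul0r; apply/eqP/negPn/(br0 (x, y, z)).
set P := colsub (adjoin3 a b c) A; have unitP : P \in unitmx by rewrite unitmxE unitfE.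
pose B := invmx P *m A; exists (bracket a b c), (usubmx B) => x y z.
have colsubE f : colsub f A = P *m colsub f B.
  rewrite -[in LHS](mulKVmx unitP A); apply/matrixP => i j; rewrite !mxE.
  by apply: eq_bigr => s _; rewrite !mxE.
have wB : colsub w B = col_mx 0 1%:M.
  have : colsub (adjoin3 a b c) B = 1%:M by rewrite -[LHS](mulKmx unitP) -colsubE mulVmx.
  rewrite colsub_adjoin3 (@scalar_mx_block _ 3 m) block_mxEh.
  by case/eq_row_mx.
rewrite {1}/bracket colsubE det_mulmx -/(bracket a b c); congr (_ * _).
rewrite colsub_adjoin3 wB -[colsub (tnth _) B]vsubmxK -block_mxEh det_lblock det1 mulr1.
by congr (\det _); apply/matrixP => i j; rewrite !mxE.
Qed.

Lemma plucker_relation a b c p q :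
  bracket a b c * bracket a p q - bracket a b p * bracket a c q
  + bracket a b q * bracket a c p = 0.
Proof.
by have [d [V brE]] := bracket_det3; rewrite !brE !det_mx33 !mxE /tnth /=; ring.
Qed.

End PluckerRelation.
End Bracket.

(** * Noncrossing matroids *)

Definition between (x p q : nat) : bool := (p < x < q) || (q < x < p).

(* For natural numbers placed on a circle in increasing order: the chords [ab] and
   [cd] cross. *)
Definition crossing (a b c d : nat) : bool := between a c d != between b c d.

Lemma crossingC a b c d : uniq [:: a; b; c; d] -> crossing a b c d = crossing c d a b.
Proof. by rewrite /crossing /between /= !inE !negb_or; lia. Qed.

Lemma crossing_pairing a b c d : uniq [:: a; b; c; d] ->
  [|| crossing a b c d, crossing a c b d | crossing a d b c].
Proof. by rewrite /crossing /between /= !inE !negb_or; lia. Qed.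

Lemma between_lt0 (R : realFieldType) (x p q : nat) :
  between x p q = ((p%:R - x%:R) * (q%:R - x%:R) < 0 :> R)%R.
Proof.
rewrite mulr_lt0 !subr_eq0 !subr_lt0 !eqr_nat !ltr_nat /between.
by case: (ltngtP p x); case: (ltngtP q x).
Qed.

Section BracketSign.
Variables (R : realFieldType) (m n : nat) (A : 'M[R]_(3 + m, n)) (w : 'I_m -> 'I_n).
Local Open Scope ring_scope.
Hypothesis Anneg : nonneg_minors A.
Local Notation br := (bracket w A).

Lemma bracket_noncrossing a b c p q : br c a b = 0 ->
  br c a p != 0 -> br c a q != 0 -> br c b p != 0 -> br c b q != 0 -> ~~ crossing a b p q.
Proof.
move=> cab cap caq cbp cbq.
have br2 : br c a p * br c b q = br c a q * br c b p.
  have := plucker_relation w A c a b p q; rewrite cab mul0r sub0r => /eqP.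
  by rewrite addrC subr_eq0 => /eqP.
have [g [d vdmE]] := vdm_adjoin3 w R.
pose h (x : 'I_n) : R := (p%:R - x%:R) * (q%:R - x%:R).
pose s : R := (a%:R - c%:R) * (b%:R - c%:R) * (p%:R - c%:R) * (q%:R - c%:R)
  * (g c ^+ 2 * g a * g b * g p * g q) * d ^+ 2.
have := mulr_gt0 (mulr_gt0 (det_colsub_vdm_gt0 Anneg cap) (det_colsub_vdm_gt0 Anneg cbq))
  (mulr_gt0 (det_colsub_vdm_gt0 Anneg caq) (det_colsub_vdm_gt0 Anneg cbp)).
rewrite !vdmE -!/(br _ _ _); set prod4 := (X in 0 < X).
have -> : prod4 = (br c a p * br c b q) * (br c a q * br c b p) * (s ^+ 2 * (h a * h b)).
  by rewrite /prod4 /s /h; ring.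
rewrite -br2 -expr2 [_ * (s ^+ 2 * _)]mulrA -exprMn => prod_gt0.
have hab : 0 < h a * h b.
  by apply: contraLR prod_gt0; rewrite -!leNgt => /(mulr_ge0_le0 (sqr_ge0 _))->.
have lt0_of_mul (x y : R) : 0 < x * y -> x < 0 -> y < 0 by move=> xy /nmulr_rgt0 <-.
rewrite negbK !(between_lt0 R) -!/(h _); apply/eqP; apply/idP/idP; apply: lt0_of_mul => //.
by rewrite mulrC.
Qed.

End BracketSign.

Definition collinear (T : finType) (M : matroid T) (x y z : T) : bool :=
  rank_of M [set x; y; z] <= 2.

Definition crossing_free (T : finType) (M : matroid T) (pos : T -> nat) : Prop :=
  forall a b c p q, [set c; a; b; p; q] \subset ground M ->
  collinear M c a b -> rank_of M [set c; a; b; p; q] <= 3 ->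
  ~~ collinear M c a p -> ~~ collinear M c a q ->
  ~~ collinear M c b p -> ~~ collinear M c b q ->
  ~~ crossing (pos a) (pos b) (pos p) (pos q).

(* All contractions are included so that the property passes to contractions. *)
Definition noncrossing (T : finType) (M : matroid T) : Prop :=
  exists2 pos : T -> nat, {in ground M &, injective pos} &
    forall C : {set T}, C \subset ground M -> crossing_free (contract M C) pos.

Section Coextension.
Variables (T : finType) (M : matroid T).
Implicit Types C S X W : {set T}.
Local Notation r := (rank_of M).

Lemma exists_coextension C S : S :|: C \subset ground M -> r (S :|: C) = #|S| + r C ->
  exists W, [/\ W \in indep M, #|W| + #|S| = matroid_rank M,
    r (C :|: W) = r W & r (S :|: W) = matroid_rank M].
Proof.
move=> sSC rSC; have [I [iI sIC cI]] := exists_basis M C.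
have [B0 [iB0 sIB0 sB0 cB0]] := indep_extend iI (subset_trans sIC (subsetUr S C)).
have [B [iB sB _ cB]] := indep_extend iB0 (subset_trans sB0 sSC).
have B0C : #|B0 :&: C| <= r C.
  by apply: indep_le_rank (subsetIr _ _); apply: indepS iB0 (subsetIl _ _).
have B0_C : B0 :\: C = S.
  apply/eqP; rewrite eqEcard; apply/andP; split; last by move: (cardsID C B0); lia.
  by apply/subsetP => x /setDP[/(subsetP sB0)/setUP[//|xC] /negP[]].
have sSB : S \subset B by rewrite -B0_C (subset_trans (subsetDl _ _)).
have sIW : I \subset B :\: S.
  rewrite -B0_C; apply/subsetP => x xI; rewrite !inE (subsetP sIC) //=.
  by rewrite (subsetP sB) // (subsetP sIB0).
exists (B :\: S); split.
- exact: indepS iB (subsetDl _ _).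
- by rewrite -[RHS]cB -(cardsID S B) (setIidPr sSB) addnC.
- by apply: (rank_ofU_spanS sIW); rewrite (setUidPl sIC) -cI indep_le_rank.
- by rewrite -[RHS]cB -{1}(setIidPr sSB) setID (rank_of_indep iB).
Qed.

Lemma rank_of_contract_coextension C S W X :
  r (C :|: W) = r W -> r (S :|: W) = rank_of (contract M C) S + r W ->
  rank_of (contract M C) (X :|: S) = rank_of (contract M C) S ->
  r (X :|: W) = rank_of (contract M C) X + r W.
Proof.
move=> spanC skewS spanX.
have rankU Y : rank_of (contract M C) (Y :|: W) + r C = r (Y :|: W).
  by rewrite rank_of_contract setUC; apply: rank_ofU_spanS (subsetUr Y W) (eq_leq spanC).
have := rank_of_contract M C W; rewrite setUC spanC => rankW.
rewrite -rankU (rank_ofU_skew _ spanX) -?addnA ?rankW //.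
by apply/(@addIn (r C)); rewrite rankU skewS -addnA rankW.
Qed.

End Coextension.

Lemma bracket_contract_neq0 (F : fieldType) (m n : nat) (A : 'M[F]_(3 + m, n))
    (w : 'I_m -> 'I_n) (C S : {set 'I_n}) x y z :
  let M := column_matroid A in let N := contract M C in let W := w @: [set: 'I_m] in
  rank_of M W = m -> rank_of M (C :|: W) = rank_of M W -> rank_of M (S :|: W) = 3 + m ->
  rank_of N S = 3 -> rank_of N ([set x; y; z] :|: S) = 3 ->
  (bracket w A x y z != 0)%R = ~~ collinear N x y z.
Proof.
move=> M N W rW spanC spanSW rNS spanS.
have skewS : rank_of M (S :|: W) = rank_of N S + rank_of M W by rewrite spanSW rNS rW.
rewrite /bracket det_colsub_neq0 adjoin3_image -/M -/W.
rewrite (rank_of_contract_coextension spanC skewS) ?spanS ?rW ?eqn_add2r //.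
rewrite eqn_leq /collinear -/N -ltnNge andb_idl // => _.
by rewrite -spanS rank_ofS ?subsetUl.
Qed.

Lemma column_crossing_free (R : realFieldType) (k n : nat) (A : 'M[R]_(k, n))
    (C : {set 'I_n}) : \rank A = k -> nonneg_minors A ->
  crossing_free (contract (column_matroid A) C) (@nat_of_ord n).
Proof.
move=> rankA Anneg a b c p q _ cab plane cap caq cbp cbq; have rM := column_matroid_rank rankA.
pose S := [set c; a; p].
have rS : rank_of (contract (column_matroid A) C) S = 3.
  apply/eqP; rewrite eqn_leq [X in _ && X]ltnNge cap andbT.
  by apply: leq_trans plane; apply: rank_ofS; set_cases.
have cS : #|S| = 3.
  apply/eqP; rewrite eqn_leq -[X in _ && (X <= _)]rS rank_of_card andbT.
  by rewrite (leq_trans (leq_card_setU _ _)) // cards1 cards2; case: (c != a).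
have rSC : rank_of (column_matroid A) (S :|: C) = #|S| + rank_of (column_matroid A) C.
  by rewrite -rank_of_contract rS cS.
have [W [iW]] := @exists_coextension _ (column_matroid A) C S (subsetT _) rSC.
rewrite rM cS addnC => kE spanC spanSW; subst k.
pose w : 'I_#|W| -> 'I_n := enum_val.
have wW : w @: [set: 'I_#|W|] = W.
  apply/setP => x; apply/imsetP/idP => [[i _ ->]|xW]; first exact: enum_valP.
  by exists (enum_rank_in xW x); rewrite ?inE // /w enum_rankK_in.
have brE x y z : [set x; y; z] \subset [set c; a; b; p; q] ->
    (bracket w A x y z != 0)%R = ~~ collinear (contract (column_matroid A) C) x y z.
  move=> xyz; apply: (bracket_contract_neq0 (S := S)) => //; rewrite ?wW // ?(rank_of_indep iW) //.
  apply/eqP; rewrite eqn_leq -[X in _ && (X <= _)]rS [X in _ && X]rank_ofS ?subsetUr // andbT.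
  by apply: leq_trans plane; apply: rank_ofS; rewrite subUset xyz; set_cases.
apply: (@bracket_noncrossing _ _ _ A w Anneg a b c); rewrite ?brE //; try by set_cases.
by apply/eqP/negPn; rewrite brE ?cab //; set_cases.
Qed.

Lemma crossing_free_image (T1 T2 : finType) (N1 : matroid T1) (N2 : matroid T2)
    (g : T1 -> T2) (pos : T2 -> nat) :
  (forall X : {set T1}, X \subset ground N1 -> g @: X \subset ground N2) ->
  (forall X : {set T1}, X \subset ground N1 -> rank_of N1 X = rank_of N2 (g @: X)) ->
  crossing_free N2 pos -> crossing_free N1 (pos \o g).
Proof.
move=> gE rankg freeN2 a b c p q sE.
have sub (X : {set T1}) : X \subset [set c; a; b; p; q] -> X \subset ground N1.
  by move/subset_trans; apply.
rewrite /collinear !rankg; do 1?[apply: sub; by set_cases].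
have := gE _ sE; rewrite !imsetU !imset_set1; exact: freeN2.
Qed.

Lemma noncrossing_iso (T1 T2 : finType) (M1 : matroid T1) (M2 : matroid T2) :
  matroid_iso M1 M2 -> noncrossing M2 -> noncrossing M1.
Proof.
move=> isoM [pos pos_inj free].
have [E0|[x0 x0E]] := set_0Vmem (ground M1).
  exists (fun=> 0) => [x y|C _ a b c p q]; first by rewrite E0 inE.
  by rewrite /= E0 set0D subset0 => /eqP/setP/(_ q); rewrite !inE eqxx orbT.
have [g isog] := matroid_iso_iso_by x0E isoM; have [injg img _] := isog.
have gE x : x \in ground M1 -> g x \in ground M2 by rewrite -img; apply: imset_f.
exists (pos \o g) => [x y xE yE /(pos_inj _ _ (gE x xE) (gE y yE))|C sC]; first exact: injg.
have sgC : g @: C \subset ground M2 by rewrite -img imsetS.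
apply: crossing_free_image (free _ sgC) => X.
  move=> sX; apply/subsetP => y /imsetP[x /(subsetP sX)/setDP[xE xC] ->].
  rewrite inE gE // andbT; apply: contra xC => /imsetP[z zC].
  by move/injg => -> //; rewrite (subsetP sC).
rewrite subsetD => /andP[sX _]; apply/(@addIn (rank_of M1 C)).
rewrite [in RHS](iso_by_rank isog) // !rank_of_contract -imsetU.
by rewrite (iso_by_rank isog) // subUset sX.
Qed.

Lemma positroid_noncrossing (R : realType) (T : finType) (M : matroid T) :
  positroid R M -> noncrossing M.
Proof.
move=> [k [n [A [rankA Anneg isoM]]]]; apply: (noncrossing_iso isoM).
by exists (@nat_of_ord n) => [i j _ _|C _]; [apply: val_inj | apply: column_crossing_free].
Qed.

Section NoncrossingMinors.
Variables (T : finType) (M : matroid T).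
Implicit Types C D X : {set T}.

Lemma noncrossing_delete D : noncrossing M -> noncrossing (delete M D).
Proof.
case=> pos pos_inj free; exists pos => [|C sC].
  by apply: sub_in2 pos_inj => x /setDP[].
have sCE : C \subset ground M by apply: subset_trans sC (subsetDl _ _).
apply: (@crossing_free_image _ _ _ (contract M C) id) (free C sCE) => X.
  by rewrite imset_id => /subset_trans; apply; apply/setSD/subsetDl.
rewrite imset_id subsetD => /andP[sX _]; apply/(@addIn (rank_of M C)).
by rewrite -{1}(rank_of_delete sC) !rank_of_contract rank_of_delete // subUset sX.
Qed.

Lemma noncrossing_contract D : D \subset ground M ->
  noncrossing M -> noncrossing (contract M D).
Proof.
move=> sD [pos pos_inj free]; exists pos => [|C sC].
  by apply: sub_in2 pos_inj => x /setDP[].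
have sCD : C :|: D \subset ground M.
  by rewrite subUset sD andbT (subset_trans sC) // subsetDl.
apply: (@crossing_free_image _ _ _ (contract M (C :|: D)) id) (free _ sCD) => X.
  by rewrite imset_id /= setDDl (setUC D).
move=> _; rewrite imset_id; apply/(@addIn (rank_of M (C :|: D))).
by rewrite -{1}rank_of_contract addnA !rank_of_contract setUA.
Qed.

End NoncrossingMinors.

Section AdmissibleMinors.
Variables (T : finType) (l : nat).
Implicit Types (M : matroid T) (C X : {set T}).

Definition admissible M : Prop :=
  [/\ simple_matroid M, noncrossing M & ~ has_minor M (uniform 2 (l + 2))].

Lemma admissible_restrict M X : admissible M -> admissible (restrict M X).
Proof.
case=> simpleM ncM no_minor; split; [exact: simple_delete|exact: noncrossing_delete|].
move=> [N mN isoN]; apply: no_minor; exists N => //; apply: minor_trans mN.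
exact/minor_delete/minor_refl.
Qed.

Lemma admissible_contract M C X : C \subset ground M -> admissible M ->
  simple_matroid (restrict (contract M C) X) -> admissible (restrict (contract M C) X).
Proof.
move=> sC [_ ncM no_minor] simpleN; split=> //.
  exact/noncrossing_delete/noncrossing_contract.
move=> [N mN isoN]; apply: no_minor; exists N => //; apply: minor_trans mN.
exact/minor_delete/minor_contract/minor_refl.
Qed.

End AdmissibleMinors.

(** * Lines of simple noncrossing matroids *)

Section Collinear.
Variables (T : finType) (M : matroid T).
Implicit Types (a b c d x y z : T) (X : {set T}).
Local Notation E := (ground M).

Lemma collinearCA x y z : collinear M x y z = collinear M y x z.
Proof. by rewrite /collinear (setUC [set x]). Qed.

Lemma collinearAC x y z : collinear M x y z = collinear M x z y.
Proof. by rewrite /collinear setUAC. Qed.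

Lemma collinear_rot x y z : collinear M x y z = collinear M y z x.
Proof. by rewrite collinearCA collinearAC. Qed.

Lemma noncollinear_uniq x y z : ~~ collinear M x y z -> uniq [:: x; y; z].
Proof.
have two u v : [set x; y; z] \subset [set u; v] -> collinear M x y z.
  by move=> /rank_ofS/leq_trans; apply; apply: rank_of2_le.
move=> xyz; rewrite /= !inE negb_or !andbT -andbA.
apply/and3P; split; apply: contraNneq xyz => eqxy.
- by apply: (two y z); rewrite eqxy; set_cases.
- by apply: (two y z); rewrite eqxy; set_cases.
- by apply: (two x z); rewrite eqxy; set_cases.
Qed.

Hypothesis simpleM : simple_matroid M.

Lemma simple_rank1 x : x \in E -> rank_of M [set x] = 1.
Proof. by case/simple_matroidP: simpleM => rank1 _; apply: rank1. Qed.

Lemma simple_rank2 x y : x \in E -> y \in E -> x != y -> rank_of M [set x; y] = 2.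
Proof. by case/simple_matroidP: simpleM => _; apply. Qed.

Lemma rank_line x y X : x \in E -> y \in E -> x != y ->
  (forall z, z \in X -> collinear M x y z) -> rank_of M (X :|: [set x; y]) = 2.
Proof.
move=> xE yE ne col; rewrite rank_ofU_span ?simple_rank2 // => z /col.
by rewrite setUC.
Qed.

Lemma rank_ofU1_collinear a b c X : a \in E -> b \in E -> a != b -> collinear M a b c ->
  [set a; b] \subset X -> rank_of M (c |: X) = rank_of M X.
Proof.
by move=> aE bE ab abc sX; rewrite (rank_ofU_spanS sX) // setUC simple_rank2.
Qed.

Lemma collinear_trans a b c d : a \in E -> b \in E -> a != b ->
  collinear M a b c -> collinear M a b d -> collinear M a c d.
Proof.
move=> aE bE ab abc abd; rewrite /collinear.
rewrite -(@rank_line a b [set c; d] aE bE ab) => [|z /set2P[]-> //].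
by apply: rank_ofS; set_cases.
Qed.

Lemma noncollinear_trans a b c d : a \in E -> c \in E -> a != c ->
  collinear M a b c -> ~~ collinear M a b d -> ~~ collinear M a c d.
Proof.
by move=> aE cE ac; rewrite collinearAC => acb; apply: contra; apply: collinear_trans.
Qed.

End Collinear.

Ltac permute_collinear :=
  first [by [] | by rewrite collinearAC | by rewrite collinearCA | by rewrite collinear_rot
       | by rewrite -collinear_rot | by rewrite collinear_rot collinearCA].

Lemma noncrossing_crossing_free (T : finType) (M : matroid T) : noncrossing M ->
  exists2 pos, {in ground M &, injective pos} & crossing_free M pos.
Proof.
case=> pos pos_inj free; exists pos => //.
apply: (@crossing_free_image _ _ _ (contract M set0) id) (free _ (sub0set _)) => X.
  by rewrite imset_id /= setD0.
by rewrite imset_id -[X in rank_of M X]setU0 -rank_of_contract rank_of0 addn0.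
Qed.

Section NoncrossingLines.
Variables (T : finType) (M : matroid T) (pos : T -> nat).
Implicit Types a b c p q s x y z : T.
Local Notation E := (ground M).
Hypotheses (simpleM : simple_matroid M) (pos_inj : {in E &, injective pos})
  (freeM : crossing_free M pos).

Lemma noncrossing_lines a b c p q : [set a; b; c; p; q] \subset E ->
  a != c -> b != c -> collinear M a b c -> collinear M b p q ->
  ~~ collinear M a b p -> ~~ collinear M a b q ->
  ~~ crossing (pos a) (pos b) (pos p) (pos q).
Proof.
rewrite !subUset !sub1set => /andP[/andP[/andP[/andP[aE bE] cE] pE] qE].
move=> ac bc abc bpq abp abq.
have ab : a != b by have /and3P[] := noncollinear_uniq abp; rewrite inE negb_or => /andP[].
have bac : collinear M b a c by rewrite collinearCA.
apply: (@freeM a b c).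
- by rewrite !subUset !sub1set aE bE cE pE.
- by rewrite collinear_rot.
- have -> : [set c; a; b; p; q] = [set c] :|: [set a; b; p; q] by set_cases.
  rewrite (rank_ofU1_collinear simpleM aE bE ab abc); last by set_cases.
  have -> : [set a; b; p; q] = a |: [set b; p; q] by set_cases.
  by apply: leq_trans (rank_ofU1_leq _ _ _) _.
- by rewrite collinearCA (noncollinear_trans simpleM aE cE ac abc).
- by rewrite collinearCA (noncollinear_trans simpleM aE cE ac abc).
- by rewrite collinearCA (noncollinear_trans simpleM bE cE bc bac) // collinearCA.
- by rewrite collinearCA (noncollinear_trans simpleM bE cE bc bac) // collinearCA.
Qed.

Lemma between_pos x y z : x \in E -> y \in E -> z \in E -> uniq [:: x; y; z] ->
  [|| between (pos x) (pos y) (pos z), between (pos y) (pos x) (pos z)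
    | between (pos z) (pos x) (pos y)].
Proof.
move=> xE yE zE; rewrite /= !inE negb_or /between.
rewrite -!(inj_in_eq pos_inj) //; lia.
Qed.

Lemma triangle_noncrossing x y z s p : [set x; y; z; s; p] \subset E ->
  ~~ collinear M x y z -> collinear M x y s -> x != s -> y != s ->
  collinear M y z p -> y != p -> ~~ crossing (pos x) (pos y) (pos z) (pos p).
Proof.
move=> sub xyz xys xs ys yzp yp.
have := sub; rewrite !subUset !sub1set => /andP[/andP[/andP[/andP[xE yE] zE] sE] pE].
have ypx : ~~ collinear M y p x.
  by rewrite (noncollinear_trans simpleM yE pE yp yzp) // -collinear_rot.
apply: (@noncrossing_lines x y s z p) => //; last by permute_collinear.
by rewrite (setUAC [set x; y]).
Qed.

End NoncrossingLines.

Section NoncrossingGeometry.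
Variables (T : finType) (M : matroid T).
Implicit Types b e p q s x y z : T.
Local Notation E := (ground M).

Definition sole_long_line e b : Prop :=
  [/\ e \in E, b \in E, e != b &
   forall x y, x \in E -> y \in E -> uniq [:: e; x; y] -> collinear M e x y ->
     collinear M e b x].

Hypotheses (simpleM : simple_matroid M) (ncM : noncrossing M).

(* [e] is the middle point of a collinear triple of minimal span: a second long line
   through [e] would be squeezed into the same span. *)
Lemma exists_sole_long_line : 2 <= rank_of M E -> exists e b, sole_long_line e b.
Proof.
have [pos pos_inj freeM] := noncrossing_crossing_free ncM; move=> rE.
pose P (t : T * T * T) := let: (a, e, c) := t in
  [&& a \in E, e \in E, c \in E, between (pos e) (pos a) (pos c) & collinear M a e c].
have exP x y z : x \in E -> y \in E -> z \in E -> uniq [:: x; y; z] -> collinear M x y z ->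
    [|| P (y, x, z), P (x, y, z) | P (x, z, y)].
  move=> xE yE zE u col; rewrite /P xE yE zE (collinearCA _ y) (collinearAC _ x z) col.
  by rewrite !andbT (between_pos pos_inj).
have [t0 Pt0|noP] := pickP P; last first.
  have /card_gt1P[e [b [eE bE eb]]] : 1 < #|E| by apply: leq_trans rE (rank_of_card _ _).
  exists e, b; split=> // x y xE yE exy col.
  by have := exP e x y eE xE yE exy col; rewrite !noP.
pose span (t : T * T * T) := (pos t.1.1 - pos t.2) + (pos t.2 - pos t.1.1).
case: (arg_minnP span Pt0) => -[[a e] c] /and5P[aE eE cE e_ac aec] min_span.
have [ea ec] : e != a /\ e != c.
  by split; apply: contraTneq e_ac => ->; rewrite /between ltnn ?andbF.
exists e, a; split=> // x y xE yE exy col; apply/negPn/negP => eax.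
have := exy; rewrite /= !inE negb_or => /and3P[/andP[ex ey] xy _].
have eac : collinear M e a c by rewrite collinearCA.
have squeezed z z' : z \in E -> z' \in E -> e != z' -> z != z' ->
    collinear M e z z' -> ~~ collinear M e z a -> between (pos z) (pos a) (pos c).
  move=> zE z'E ez' zz' ezz' eza.
  have ezc : ~~ collinear M e z c.
    by rewrite collinearAC (noncollinear_trans simpleM eE cE ec eac) // collinearAC.
  have : ~~ crossing (pos z) (pos e) (pos a) (pos c).
    apply: (noncrossing_lines (c := z') simpleM freeM) => //; try permute_collinear.
    by rewrite !subUset !sub1set zE eE z'E aE.
  by rewrite negbK e_ac => /eqP.
have eya : ~~ collinear M e y a.
  by rewrite (noncollinear_trans simpleM eE yE ey col) // collinearAC.
have x_ac : between (pos x) (pos a) (pos c).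
  by apply: (squeezed x y) => //; permute_collinear.
have y_ac : between (pos y) (pos a) (pos c).
  by apply: (squeezed y x) => //; [rewrite eq_sym | permute_collinear].
have := exP e x y eE xE yE exy col; move: e_ac x_ac y_ac; clear - min_span.
by rewrite /between => e_ac x_ac y_ac /or3P[]/min_span; rewrite /span /=; lia.
Qed.

(* Otherwise the chord [yz] separates [x] from [p], but [q] from neither of them. *)
Lemma no_complete_quadrilateral x y z p q s :
  [set x; y; z; p; q; s] \subset E -> [disjoint [set x; y; z] & [set p; q; s]] ->
  ~~ collinear M x y z -> collinear M y z p -> collinear M x z q -> collinear M x y s ->
  ~~ collinear M p q s.
Proof.
have [pos pos_inj freeM] := noncrossing_crossing_free ncM.
rewrite !subUset !sub1set => /andP[/andP[/andP[/andP[/andP[xE yE] zE] pE] qE] sE].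
rewrite disjoints_subset !subUset !sub1set !inE !negb_or -!andbA.
case/and5P=> xp xq xs yp /and5P[yq ys zp zq zs].
move=> xyz yzp xzq xys.
have := noncollinear_uniq xyz; rewrite /= !inE negb_or => /and3P[/andP[xy xz] yz _].
have ypx : ~~ collinear M y p x.
  by rewrite (noncollinear_trans simpleM yE pE yp yzp) // -collinear_rot.
have xqy : ~~ collinear M x q y.
  by rewrite (noncollinear_trans simpleM xE qE xq xzq) // collinearAC.
have zxq : collinear M z x q by rewrite collinearCA.
have zqy : ~~ collinear M z q y.
  by rewrite (noncollinear_trans simpleM zE qE zq zxq) // collinear_rot.
have ypq : ~~ collinear M y p q.
  by rewrite (noncollinear_trans simpleM yE pE yp yzp) // collinear_rot.
have ps : p != s by apply: contraNneq ypx => ->; permute_collinear.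
have qs : q != s by apply: contraNneq xqy => ->; permute_collinear.
have pos_uniq a b c d : a \in E -> b \in E -> c \in E -> d \in E ->
    uniq [:: pos a; pos b; pos c; pos d] = uniq [:: a; b; c; d].
  by move=> aE bE cE dE; rewrite /= !inE !(inj_in_eq pos_inj).
have sub5 a b c d e : a \in E -> b \in E -> c \in E -> d \in E -> e \in E ->
    [set a; b; c; d; e] \subset E.
  by move=> aE bE cE dE eE; rewrite !subUset !sub1set aE bE cE dE.
apply/negP => pqs.
have xy_zp : ~~ crossing (pos x) (pos y) (pos z) (pos p).
  by apply: (triangle_noncrossing (s := s) simpleM freeM); rewrite ?sub5.
have xz_yp : ~~ crossing (pos x) (pos z) (pos y) (pos p).
  by apply: (triangle_noncrossing (s := q) simpleM freeM); rewrite ?sub5 //; permute_collinear.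
have xq_yz : ~~ crossing (pos x) (pos q) (pos y) (pos z).
  rewrite crossingC ?pos_uniq //; last first.
    by rewrite /= !inE !negb_or xq xy xz yz ![q == _]eq_sym yq zq.
  by apply: (triangle_noncrossing (s := p) simpleM freeM); rewrite ?sub5 //; permute_collinear.
have qp_yz : ~~ crossing (pos q) (pos p) (pos y) (pos z).
  have pz : p != z by rewrite eq_sym.
  by apply: (triangle_noncrossing (s := s) simpleM freeM); rewrite ?sub5 //; permute_collinear.
have := @crossing_pairing (pos x) (pos y) (pos z) (pos p).
rewrite pos_uniq // /= !inE !negb_or xy xz xp yz yp zp (negbTE xy_zp) (negbTE xz_yp) /=.
move/(_ isT); move: xq_yz qp_yz; rewrite /crossing.
by case: between; case: between; case: between.
Qed.

End NoncrossingGeometry.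

(** * The bound *)

Lemma line_card_le (T : finType) (l : nat) (M : matroid T) (X : {set T}) :
  admissible l M -> X \subset ground M -> rank_of M X <= 2 -> #|X| <= l + 1.
Proof.
move=> [simpleM _ no_minor] sX rX; rewrite leqNgt; apply/negP => cX; apply: no_minor.
have /card_geqP[s [uniqs sizes sX']] : l + 2 <= #|X| by rewrite addn2 -addn1.
have sY : [set x in s] \subset X by apply/subsetP => x; rewrite inE => /sX'.
have sYE := subset_trans sY sX.
exists (restrict M [set x in s]); first exact/minor_delete/minor_refl.
rewrite addn2; apply: simple_iso_uniform2; first exact: simple_delete.
  by rewrite matroid_rank_restrict // (leq_trans _ rX) ?rank_ofS.
by rewrite ground_restrict // cardsE (card_uniqP uniqs) sizes addn2.
Qed.

Section PointContraction.
Variables (T : finType) (M : matroid T) (e : T) (X : {set T}).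
Implicit Types (Y : {set T}) (x y : T).
Local Notation E := (ground M).

Definition point_contraction : matroid T := restrict (contract M [set e]) X.

Hypotheses (simpleM : simple_matroid M) (eE : e \in E) (sX : X \subset E :\ e).

Lemma ground_point_contraction : ground point_contraction = X.
Proof. exact: ground_restrict. Qed.

Lemma rank_point_contraction Y : Y \subset X ->
  rank_of M (e |: Y) = (rank_of point_contraction Y).+1.
Proof.
move=> sY; rewrite rank_restrict // -addn1 -(simple_rank1 simpleM eE).
by rewrite rank_of_contract setUC.
Qed.

Lemma simple_point_contraction :
  {in X &, forall x y, x != y -> ~~ collinear M e x y} -> simple_matroid point_contraction.
Proof.
have inX x : x \in X -> x \in E /\ e != x.
  by move=> /(subsetP sX)/setD1P[xe xE]; rewrite eq_sym.
move=> noline; apply/simple_matroidP; rewrite ground_point_contraction.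
split=> [x xX|x y xX yX ne]; apply: succn_inj;
  rewrite -rank_point_contraction ?subUset ?sub1set ?xX //.
  by have [xE ex] := inX x xX; rewrite simple_rank2.
have [xE ex] := inX x xX; have := noline x y xX yX ne.
rewrite /collinear -ltnNge -setUA => rk; apply/eqP; rewrite eqn_leq rk andbT.
by rewrite (leq_trans (rank_ofU1_leq _ _ _)) // ltnS rank_of2_le.
Qed.

Lemma admissible_point_contraction l : admissible l M ->
  {in X &, forall x y, x != y -> ~~ collinear M e x y} -> admissible l point_contraction.
Proof.
move=> adM noline; apply: admissible_contract; rewrite ?sub1set //.
exact: simple_point_contraction.
Qed.

End PointContraction.

Section LineContraction.
Variables (T : finType) (M : matroid T) (l : nat) (e b : T).
Implicit Types (X Y : {set T}) (x y : T).
Local Notation E := (ground M).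
Local Notation L := (matroid_closure M [set e; b]).

(* One representative of each line through [e], the point [b] for the line [eb]. *)
Definition line_contraction : matroid T := point_contraction M e (E :\: (L :\ b)).

Hypotheses (adM : admissible l M) (sole : sole_long_line M e b).
Let simpleM : simple_matroid M. Proof. by case: adM. Qed.
Let eE : e \in E. Proof. by case: sole. Qed.
Let bE : b \in E. Proof. by case: sole. Qed.
Let eb : e != b. Proof. by case: sole. Qed.
Local Notation X := (E :\: (L :\ b)).

Lemma sub_line : [set e; b] \subset L.
Proof. by apply: sub_closure; rewrite subUset !sub1set eE. Qed.

Lemma mem_line x : x \in E -> collinear M e b x -> x \in L.
Proof.
move=> xE ebx; rewrite inE xE /= eqn_leq [X in _ && X]rank_ofS ?subsetUr // andbT.
by rewrite (simple_rank2 simpleM eE bE eb) setUC.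
Qed.

Lemma line_contraction_sub : X \subset E :\ e.
Proof.
have eL : e \in L by apply: (subsetP sub_line); rewrite set21.
apply/subsetP => x; rewrite !in_setD !in_set1 => /andP[xLb xE]; rewrite xE andbT.
by apply: contraNneq xLb => ->; rewrite eb.
Qed.

Lemma line_contraction_mem : b \in X.
Proof. by rewrite in_setD in_setD1 eqxx. Qed.

Lemma ground_line_contraction : ground line_contraction = X.
Proof. exact: ground_point_contraction line_contraction_sub. Qed.

Lemma line_contractionU : L :|: X = E.
Proof.
apply/setP => x; rewrite in_setU in_setD in_setD1; case: (boolP (x \in L)) => [xL|_].
  by rewrite (subsetP (closure_sub_ground M _) x xL).
by rewrite andbF.
Qed.

Lemma admissible_line_contraction : admissible l line_contraction.
Proof.
apply: admissible_point_contraction line_contraction_sub _ adM _ => //.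
move=> x y xX yX ne; apply/negP => exy.
have [_ _ _ only_eb] := sole.
have onlyb u v : u \in X -> v \in X -> u != v -> collinear M e u v -> u = b.
  move=> uX vX uv euv; move: (uX); rewrite in_setD in_setD1 negb_and negbK.
  case/andP=> [/orP[/eqP//|uL] uE]; case/negP: uL; apply: mem_line => //.
  have /setD1P[ue _] := subsetP line_contraction_sub u uX.
  have /setD1P[ve vE] := subsetP line_contraction_sub v vX.
  by apply: (only_eb u v); rewrite // /= !inE negb_or uv ![e == _]eq_sym ue ve.
have xb := onlyb x y xX yX ne exy.
have yb : y = b by apply: (onlyb y x) => //; [rewrite eq_sym | permute_collinear].
by rewrite xb yb eqxx in ne.
Qed.

Lemma rank_line_contraction Y : b \in Y -> Y \subset X ->
  rank_of M (L :|: Y) = (rank_of line_contraction Y).+1.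
Proof.
move=> bY sY; rewrite -rank_point_contraction ?line_contraction_sub //.
have sub : [set e; b] \subset e |: Y by rewrite subUset !sub1set setU11 setU1r.
have eLY : e \in L :|: Y by rewrite in_setU (subsetP sub_line) ?set21.
by rewrite -(rank_ofU_spanS sub (eq_leq (rank_closureU M _))) setUCA (setU1_id eLY).
Qed.

Lemma matroid_rank_line_contraction : matroid_rank M = (matroid_rank line_contraction).+1.
Proof.
rewrite {2}/matroid_rank ground_line_contraction -rank_line_contraction //.
  by rewrite line_contractionU.
exact: line_contraction_mem.
Qed.

Lemma card_line_contraction : #|E| <= #|ground line_contraction| + l.
Proof.
have rL : rank_of M L <= 2.
  by rewrite rank_closure ?subUset ?sub1set ?eE // rank_of2_le.
have := line_card_le adM (closure_sub_ground M _) rL.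
have bL : b \in L by apply: (subsetP sub_line); rewrite set22.
rewrite ground_line_contraction (cardsD1 b L) bL.
have := cardsID (L :\ b) E; have := subset_leq_card (subsetIr E (L :\ b)); lia.
Qed.

End LineContraction.

Theorem admissible_card_le (T : finType) (l : nat) (M : matroid T) : admissible l M ->
  #|ground M| <= l * (matroid_rank M - 1) + 1.
Proof.
have [k leM] := ubnP (matroid_rank M); elim: k M leM => // k IHk M leM adM.
have [simpleM ncM _] := adM.
have [r1|r2] := leqP (matroid_rank M) 1.
  suff : #|ground M| <= 1 by lia.
  apply/card_le1_eqP => x y xE yE; apply/eqP/negPn/negP => ne.
  have : rank_of M [set y; x] <= matroid_rank M.
    by apply: rank_ofS; rewrite subUset !sub1set xE yE.
  by rewrite (simple_rank2 simpleM yE xE ne); lia.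
have [e [b sole]] := exists_sole_long_line simpleM ncM r2.
have rN := matroid_rank_line_contraction adM sole.
have := card_line_contraction adM sole.
have := IHk _ _ (admissible_line_contraction adM sole); rewrite -ltnS -rN leM => /(_ isT).
move: (#|ground (line_contraction _ _ _)|) => cN.
have -> : matroid_rank M - 1 = (matroid_rank (line_contraction M e b) - 1).+1 by lia.
by rewrite mulnS; lia.
Qed.

(** * Parallel connections *)

Section ModularPair.
Variables (T : finType) (M : matroid T) (E1 E2 : {set T}) (p : T).
Implicit Types (X F : {set T}) (x : T).
Local Notation E := (ground M).
Local Notation r := (rank_of M).
Hypotheses (E12U : E1 :|: E2 = E) (E12I : E1 :&: E2 = [set p]) (rp : r [set p] = 1)
  (modular : r E1 + r E2 = matroid_rank M + 1).

Lemma modular_rankU X1 X2 : X1 \subset E1 -> X2 \subset E2 -> p \in X1 -> p \in X2 ->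
  r (X1 :|: X2) + 1 = r X1 + r X2.
Proof.
move=> sX1 sX2 pX1 pX2; apply/eqP; rewrite eqn_leq; apply/andP; split.
  apply: leq_trans (rank_of_submod M X1 X2); rewrite leq_add2l -rp.
  by apply: rank_ofS; rewrite sub1set inE pX1.
have sub1 : r X1 + r (E1 :|: X2) <= r E1 + r (X1 :|: X2).
  have := rank_of_submod M E1 (X1 :|: X2); rewrite setUA (setUidPl sX1) addnC.
  by apply: leq_trans; rewrite leq_add2r rank_ofS // subsetI sX1 subsetUl.
have sub2 : r X2 + matroid_rank M <= r E2 + r (E1 :|: X2).
  have := rank_of_submod M (E1 :|: X2) E2; rewrite -setUA (setUidPr sX2) E12U addnC.
  rewrite [X in _ <= X]addnC; apply: leq_trans.
  by rewrite leq_add2r rank_ofS // subsetI sX2 subsetUr.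
lia.
Qed.

Lemma modular_rankU_unspanned X1 X2 : X1 \subset E1 -> X2 \subset E2 ->
  r X2 < r (p |: X2) -> r (X1 :|: X2) = r X1 + r X2.
Proof.
move=> sX1 sX2 pX2; have [pE1 pE2] : p \in E1 /\ p \in E2 by apply/setIP; rewrite E12I set11.
apply/eqP; rewrite eqn_leq rank_ofU_leq /=.
have rU : r (p |: (X1 :|: X2)) + 1 = r (p |: X1) + r (p |: X2).
  by rewrite setUUr modular_rankU ?setU11 // subUset sub1set ?pE1 ?pE2.
have := rank_ofS M (subsetUr [set p] X1).
have := rank_ofU1_leq M p X2; have := rank_ofU1_leq M p X1.
have := rank_ofU1_leq M p (X1 :|: X2).
have [pX1|spanX1] := ltnP (r X1) (r (p |: X1)); first by lia.
have spanU : r ([set p] :|: (X1 :|: X2)) = r (X1 :|: X2).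
  exact: rank_ofU_spanS (subsetUl X1 X2) spanX1.
lia.
Qed.

Lemma modular_flat_rankU1 F x : F \subset E ->
  flat (restrict M E1) (F :&: E1) -> flat (restrict M E2) (F :&: E2) ->
  x \in E1 -> x \notin F -> r F < r (x |: F).
Proof.
have [sE1 sE2] : E1 \subset E /\ E2 \subset E by rewrite -E12U subsetUl subsetUr.
move=> sF /(flat_restrictP sE1 (subsetIr _ _)) ltF1 /(flat_restrictP sE2 (subsetIr _ _)) ltF2.
move=> xE1 xF; have FE : F = (F :&: E1) :|: (F :&: E2) by rewrite -setIUr E12U (setIidPl sF).
have [pE1 pE2] : p \in E1 /\ p \in E2 by apply/setIP; rewrite E12I set11.
have ltx : r (F :&: E1) < r (x |: (F :&: E1)) by apply: ltF1; rewrite // inE (negbTE xF).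
have sxF1 : x |: (F :&: E1) \subset E1 by rewrite subUset sub1set xE1 subsetIr.
have [pF|pF] := boolP (p \in F).
  have := modular_rankU sxF1 (subsetIr F E2).
  have := modular_rankU (subsetIr F E1) (subsetIr F E2).
  rewrite -setUA -FE !inE pF pE1 pE2 orbT => /(_ isT isT) rF /(_ isT isT) rxF.
  by rewrite -(ltn_add2r 1) rF rxF ltn_add2r.
have ltp : r (F :&: E2) < r (p |: (F :&: E2)) by apply: ltF2; rewrite // inE (negbTE pF).
have := modular_rankU_unspanned sxF1 (subsetIr F E2) ltp.
have := modular_rankU_unspanned (subsetIr F E1) (subsetIr F E2) ltp.
by rewrite -setUA -FE => -> ->; rewrite ltn_add2r.
Qed.

End ModularPair.

Theorem modular_parallel_connection (T : finType) (M : matroid T) (E1 E2 : {set T}) (p : T) :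
  E1 :|: E2 = ground M -> E1 :&: E2 = [set p] -> rank_of M [set p] = 1 ->
  rank_of M E1 + rank_of M E2 = matroid_rank M + 1 ->
  is_parallel_connection p (restrict M E1) (restrict M E2) M.
Proof.
move=> E12U E12I rp modular.
have [sE1 sE2] : E1 \subset ground M /\ E2 \subset ground M by rewrite -E12U subsetUl subsetUr.
split; rewrite ?ground_restrict // => F; rewrite E12U.
apply/idP/and3P => [fF|[sF fF1 fF2]].
  by split; [case/flatP: fF | apply: flat_restrict | apply: flat_restrict].
apply/flatP; split=> // x; rewrite -E12U => /setUP[xE1|xE2] xF.
  exact: (modular_flat_rankU1 E12U E12I rp modular).
have E21U : E2 :|: E1 = ground M by rewrite setUC.
have E21I : E2 :&: E1 = [set p] by rewrite setIC.
have modular' : rank_of M E2 + rank_of M E1 = matroid_rank M + 1 by rewrite addnC.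
exact: (modular_flat_rankU1 E21U E21I rp modular').
Qed.

Section ParallelConnectionRank.
Variable T : finType.
Implicit Types (M : matroid T) (F : {set T}) (e x : T).

Lemma loopless_indep1 M x : flat M set0 -> x \in ground M -> [set x] \in indep M.
Proof.
move=> /flatP[_ lt0] xE; have := lt0 x xE; rewrite inE setU0 rank_of0 => /(_ isT) rx.
by rewrite indepE cards1 eqn_leq rank_of1_le.
Qed.

Lemma parallel_connection_rank_le e M1 M2 M : is_parallel_connection e M1 M2 M ->
  [set e] \in indep M1 -> [set e] \in indep M2 ->
  matroid_rank M + 1 <= matroid_rank M1 + matroid_rank M2.
Proof.
move=> [_ gU flatM] ie1 ie2.
have [B1 [iB1 eB1 sB1 cB1]] := indep_extend ie1 (indep_ground ie1).
have [B2 [iB2 eB2 sB2 cB2]] := indep_extend ie2 (indep_ground ie2).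
have sB : B1 :|: B2 \subset ground M by rewrite gU setUSS.
have full (N : matroid T) B F : B \in indep N -> B \subset ground N ->
    #|B| = matroid_rank N -> B \subset F -> flat N (F :&: ground N) -> ground N \subset F.
  move=> iB sBN cB sBF fF; apply/setIidPr/(flat_spanning fF).
  by rewrite -cB indep_le_rank // subsetI sBF.
have sCl := sub_closure sB; have /[!flatM] /and3P[_ f1 f2] := flat_closure sB.
have E_Cl : ground M \subset matroid_closure M (B1 :|: B2).
  have s1 := subset_trans (subsetUl B1 B2) sCl; have s2 := subset_trans (subsetUr B1 B2) sCl.
  by rewrite gU subUset (full M1 B1) // (full M2 B2).
have rM : matroid_rank M <= #|B1 :|: B2|.
  apply: leq_trans (rank_of_card M _); rewrite -(rank_closure sB).
  exact: rank_ofS.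
have cI : 0 < #|B1 :&: B2| by apply/card_gt0P; exists e; rewrite inE -!sub1set eB1.
by have := leq_add rM cI; rewrite cardsUI cB1 cB2.
Qed.

Theorem parallel_connections_card_ge l M : parallel_connections_of (uniform 2 (l + 1)) M ->
  flat M set0 /\ l * (matroid_rank M - 1) + 1 <= #|ground M|.
Proof.
elim=> {M} [M|e M1 M2 M _ [fl1 c1] _ [fl2 c2] pc].
  rewrite addn1 => /iso_uniform2[fl rM ->]; split=> //.
  by rewrite addn1 ltnS -{2}(muln1 l) leq_mul2l leq_subLR rM orbT.
have [gI gU flatM] := pc; split; first by rewrite flatM !set0I fl1 fl2 sub0set.
have [eE1 eE2] : e \in ground M1 /\ e \in ground M2 by apply/setIP; rewrite gI set11.
have [ie1 ie2] := (loopless_indep1 fl1 eE1, loopless_indep1 fl2 eE2).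
have rk := parallel_connection_rank_le pc ie1 ie2.
have rk_gt0 (N : matroid T) : [set e] \in indep N -> 0 < matroid_rank N.
  by move=> ie; have := indep_le_rank ie (indep_ground ie); rewrite cards1.
have r1 := rk_gt0 _ ie1; have r2 := rk_gt0 _ ie2.
have := cardsUI (ground M1) (ground M2); rewrite -gU gI cards1.
have : l * (matroid_rank M - 1) <= l * ((matroid_rank M1 - 1) + (matroid_rank M2 - 1)).
  by rewrite leq_mul2l; apply/orP; right; lia.
rewrite mulnDr; lia.
Qed.

End ParallelConnectionRank.

(** * The case of equality *)

Definition extremal (T : finType) (l : nat) (M : matroid T) : Prop :=
  #|ground M| = l * (matroid_rank M - 1) + 1.

Definition large_hyperplane (T : finType) (l : nat) (M : matroid T) (H : {set T}) : Prop :=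
  [/\ H \subset ground M, rank_of M H < matroid_rank M & #|ground M :\: H| <= l].

Section LargeHyperplane.
Variables (T : finType) (l : nat) (M : matroid T) (H : {set T}).
Implicit Types (X : {set T}) (h p q s x y z : T).
Local Notation r := (rank_of M).
Local Notation E := (ground M).
Hypotheses (adM : admissible l M) (extM : extremal l M) (rankM : 2 <= matroid_rank M)
  (largeH : large_hyperplane l M H).

Let simpleM : simple_matroid M. Proof. by case: adM. Qed.
Let sH : H \subset E. Proof. by case: largeH. Qed.

Lemma subset_card_le X : X \subset E -> #|X| <= l * (r X - 1) + 1.
Proof.
move=> sX; have := admissible_card_le (admissible_restrict X adM).
by rewrite ground_restrict // matroid_rank_restrict.
Qed.

Lemma hyperplane_card_le X : X \subset E -> r X < matroid_rank M ->
  #|X| <= l * (matroid_rank M - 2) + 1.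
Proof.
move=> sX rX; apply: leq_trans (subset_card_le sX) _.
by rewrite leq_add2r leq_mul2l; apply/orP; right; lia.
Qed.

Lemma large_hyperplane_card :
  #|H| = l * (matroid_rank M - 2) + 1 /\ #|E :\: H| = l.
Proof.
have [_ rH cH] := largeH; have := hyperplane_card_le sH rH.
have := cardsID H E; rewrite (setIidPr sH) extM.
have -> : matroid_rank M - 1 = (matroid_rank M - 2).+1 by lia.
by rewrite mulnS; lia.
Qed.

Lemma spanning_outside x : x \in E -> x \notin H -> r (x |: H) = matroid_rank M.
Proof.
move=> xE xH; have sxH : x |: H \subset E by rewrite subUset sub1set xE.
apply/eqP; rewrite eqn_leq rank_ofS //= leqNgt; apply/negP => /(hyperplane_card_le sxH).
by rewrite cardsU1 xH; have [-> _] := large_hyperplane_card; rewrite ltnn.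
Qed.

Lemma rank_outside x X : x \in E -> x \notin H -> X \subset H -> r (x |: X) = (r X).+1.
Proof.
move=> xE xH sX; apply/eqP; rewrite eqn_leq rank_ofU1_leq ltnNge; apply/negP => spanX.
have [_ rH _] := largeH; have := spanning_outside xE xH.
by rewrite (rank_ofU_spanS sX spanX) => rHM; rewrite rHM ltnn in rH.
Qed.

Lemma rank_large_hyperplane : matroid_rank M = (r H).+1.
Proof.
have [_ rH _] := largeH.
have /subsetPn[x xE xH] : ~~ (E \subset H).
  by apply: contraL rH => sE; rewrite -leqNgt rank_ofS.
by rewrite -(spanning_outside xE xH) rank_outside.
Qed.

Lemma matroid_rank_restrict_hyperplane :
  matroid_rank M = (matroid_rank (restrict M H)).+1.
Proof. by rewrite matroid_rank_restrict // rank_large_hyperplane. Qed.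

Lemma extremal_restrict_hyperplane : extremal l (restrict M H).
Proof.
rewrite /extremal ground_restrict //; have [-> _] := large_hyperplane_card.
by rewrite matroid_rank_restrict_hyperplane.
Qed.

(* Otherwise [y |: H] is simple in the contraction of [x] and has one element too many. *)
Lemma line_meets_hyperplane x y : x \in E :\: H -> y \in E :\: H -> x != y ->
  exists2 h, h \in H & collinear M x y h.
Proof.
move=> /setDP[xE xH] /setDP[yE yH] xy; apply/exists_inP; apply: contraT.
rewrite negb_exists_in => /forall_inP miss; exfalso.
have sY : y |: H \subset E :\ x.
  by rewrite subsetD1 subUset sub1set yE sH in_setU1 negb_or xy.
have adN : admissible l (point_contraction M x (y |: H)).
  apply: admissible_point_contraction => // u v; rewrite !in_setU1.
  case/orP=> [/eqP->|uH] /orP[/eqP->|vH]; rewrite ?eqxx // => uv.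
  - exact: miss.
  - by rewrite collinearAC miss.
  - rewrite /collinear -setUA rank_outside ?subUset ?sub1set ?uH //.
    by rewrite simple_rank2 // (subsetP sH).
have := admissible_card_le adN; rewrite /matroid_rank ground_point_contraction //.
rewrite cardsU1 yH; have [-> _] := large_hyperplane_card.
have := rank_point_contraction simpleM xE sY (subxx _).
have : r (x |: (y |: H)) <= matroid_rank M.
  by apply: rank_ofS; rewrite subUset sub1set xE (subset_trans sY) // subD1set.
move: (rank_of _ (y |: H)) => rN rle rE.
have : l * (rN - 1) <= l * (matroid_rank M - 2) by rewrite leq_mul2l; apply/orP; right; lia.
lia.
Qed.

Lemma outside_triangle_collinear x y z p q s :
  x \in E :\: H -> y \in E :\: H -> z \in E :\: H -> p \in H -> q \in H -> s \in H ->
  uniq [:: x; y; z] -> collinear M y z p -> collinear M x z q -> collinear M x y s ->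
  collinear M p q s.
Proof.
move=> /setDP[xE xH] /setDP[yE _] /setDP[zE _] pH qH sH'.
rewrite /= !inE negb_or => /and3P[/andP[xy xz] yz _] yzp xzq xys.
have spqs : [set p; q; s] \subset H by rewrite !subUset !sub1set pH qH.
rewrite /collinear -ltnS -(rank_outside xE xH spqs).
apply: leq_trans (_ : r (p |: (q |: (s |: [set x; y; z]))) <= _).
  by apply: rank_ofS; set_cases.
rewrite (rank_ofU1_collinear simpleM yE zE yz yzp); last by set_cases.
rewrite (rank_ofU1_collinear simpleM xE zE xz xzq); last by set_cases.
rewrite (rank_ofU1_collinear simpleM xE yE xy xys); last by set_cases.
by rewrite setUC (leq_trans (rank_ofU1_leq _ _ _)) // ltnS rank_of2_le.
Qed.

Lemma exists_leaf_point : exists2 p, p \in H & r (p |: (E :\: H)) <= 2.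
Proof.
have [le1|/card_gt1P[x [y [xS yS xy]]]] := leqP #|E :\: H| 1.
  have [h hH] : exists h, h \in H.
    by apply/card_gt0P; have [-> _] := large_hyperplane_card; rewrite addn1.
  exists h => //; apply: leq_trans (rank_of_card _ _) _.
  by rewrite cardsU1 in_setD hH.
have inE' u : u \in E :\: H -> u \in E by case/setDP.
have [s sH' xys] := line_meets_hyperplane xS yS xy; exists s => //.
apply: leq_trans (rank_ofS _ (subsetUl _ [set x; y])) _.
rewrite (rank_line simpleM (inE' x xS) (inE' y yS) xy) // => z /setU1P[->//|zS].
apply/negPn/negP => xyz; have u := noncollinear_uniq xyz.
have := u; rewrite /= !inE negb_or => /and3P[/andP[_ xz] yz _].
have [q qH xzq] := line_meets_hyperplane xS zS xz.
have [p pH yzp] := line_meets_hyperplane yS zS yz.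
have [_ ncM _] := adM.
have := outside_triangle_collinear xS yS zS pH qH sH' u yzp xzq xys.
apply/negP; apply: (no_complete_quadrilateral simpleM ncM) xyz yzp xzq xys.
  by rewrite !subUset !sub1set (inE' x) ?(inE' y) ?(inE' z) ?(subsetP sH).
rewrite disjoints_subset (subset_trans (_ : _ \subset E :\: H)) //.
  by rewrite !subUset !sub1set xS yS.
rewrite setDE (subset_trans (subsetIr _ _)) // setCS.
by rewrite !subUset !sub1set pH qH.
Qed.

Section Leaf.
Variable p : T.
Hypothesis pH : p \in H.
Local Notation K := (p |: (E :\: H)).
Hypothesis rK : r K <= 2.

Lemma leaf_sub : K \subset E.
Proof. by rewrite subUset sub1set (subsetP sH) // subsetDl. Qed.

Lemma leafU : K :|: H = E.
Proof.
apply/eqP; rewrite eqEsubset subUset leaf_sub sH /=; apply/subsetP => x xE.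
by rewrite !inE xE; case: (x \in H); rewrite ?orbT.
Qed.

Lemma leafI : K :&: H = [set p].
Proof.
apply/setP => x; rewrite !inE; case: (eqVneq x p) => [->|_]; first by rewrite pH.
by case: (x \in H); rewrite ?andbF.
Qed.

Lemma leaf_modular : r K + r H = matroid_rank M + 1.
Proof.
apply/eqP; rewrite eqn_leq; apply/andP; split; first by rewrite rank_large_hyperplane; lia.
apply: leq_trans (rank_of_submod M K H); rewrite leafU leafI.
by rewrite (simple_rank1 simpleM (subsetP sH p pH)).
Qed.

Lemma leaf_parallel_connection : is_parallel_connection p (restrict M K) (restrict M H) M.
Proof.
apply: modular_parallel_connection leafU leafI _ leaf_modular.
by rewrite (simple_rank1 simpleM (subsetP sH p pH)).
Qed.

Lemma leaf_uniform2 : matroid_iso (restrict M K) (uniform 2 (l + 1)).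
Proof.
rewrite addn1; apply: simple_iso_uniform2; first exact: simple_delete.
  by rewrite matroid_rank_restrict ?leaf_sub.
have [_ cS] := large_hyperplane_card.
by rewrite ground_restrict ?leaf_sub // cardsU1 in_setD pH cS.
Qed.

Lemma large_hyperplaneU_leaf G : large_hyperplane l (restrict M H) G -> p \in G ->
  large_hyperplane l M (G :|: K).
Proof.
rewrite /large_hyperplane ground_restrict // matroid_rank_restrict // => -[sG rG cG] pG.
split.
- by rewrite subUset leaf_sub (subset_trans sG).
- rewrite rank_restrict // in rG.
  have := rank_of_submod M G K; have : 1 <= r (G :&: K).
    rewrite -(simple_rank1 simpleM (subsetP sH p pH)).
    by apply: rank_ofS; rewrite sub1set inE pG setU11.
  by rewrite rank_large_hyperplane; lia.
- apply: leq_trans cG; apply: subset_leq_card; apply/subsetP => x.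
  rewrite !inE !negb_or => /andP[/and3P[-> _]].
  by case: (x \in H) => //= /negPf->.
Qed.

End Leaf.
End LargeHyperplane.

Section ExtremalContraction.
Variables (T : finType) (l : nat) (M : matroid T) (e b : T).
Local Notation N := (line_contraction M e b).
Hypotheses (adM : admissible l M) (extM : extremal l M) (sole : sole_long_line M e b).

Lemma extremal_line_contraction : 2 <= matroid_rank M -> extremal l N.
Proof.
move=> rM; apply/eqP; rewrite eqn_leq; apply/andP; split.
  exact/admissible_card_le/admissible_line_contraction.
have := card_line_contraction adM sole; rewrite extM.
have rN := matroid_rank_line_contraction adM sole.
have -> : matroid_rank M - 1 = (matroid_rank N - 1).+1 by lia.
by rewrite mulnS; lia.
Qed.

Lemma large_hyperplane_line_contraction H : large_hyperplane l N H -> b \in H ->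
  large_hyperplane l M (matroid_closure M [set e; b] :|: H).
Proof.
case; rewrite (ground_line_contraction sole) => sH rH cH bH; split.
- by rewrite subUset closure_sub_ground (subset_trans sH) ?subsetDl.
- by rewrite (rank_line_contraction adM sole) // (matroid_rank_line_contraction adM sole).
apply: leq_trans cH; apply: subset_leq_card; apply/subsetP => x.
by rewrite !in_setD in_setU negb_or => /andP[/andP[/negPf-> ->] ->]; rewrite andbF.
Qed.

End ExtremalContraction.

(* The point [a] is prescribed since a hyperplane of [line_contraction M e b] lifts to [M]
   only if it contains [b]. *)
Theorem exists_large_hyperplane (T : finType) (l : nat) (M : matroid T) (a : T) :
  admissible l M -> extremal l M -> 2 <= matroid_rank M -> a \in ground M ->
  exists2 H, large_hyperplane l M H & a \in H.
Proof.
move=> adM extM rM; have [n rME] : exists n, matroid_rank M = n.+2.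
  by exists (matroid_rank M - 2); lia.
elim: n M a adM extM rM rME => [|n IHn] M a adM extM rM rME aE.
  exists [set a]; rewrite ?inE //; split; rewrite ?sub1set //.
    by rewrite rME ltnS rank_of1_le.
  by move: extM; rewrite /extremal rME muln1 (cardsD1 a (ground M)) aE; lia.
have [simpleM ncM _] := adM.
have [e [b sole]] := exists_sole_long_line simpleM ncM rM.
have rN : matroid_rank (line_contraction M e b) = n.+2.
  by apply: succn_inj; rewrite -(matroid_rank_line_contraction adM sole).
have [|||H' largeH' bH'] := IHn _ b (admissible_line_contraction adM sole) _ _ rN.
- exact: extremal_line_contraction.
- by rewrite rN.
- by rewrite (ground_line_contraction sole) (line_contraction_mem sole).
have largeH := large_hyperplane_line_contraction adM sole largeH' bH'.
set H := _ :|: _ in largeH; have [aH|aH] := boolP (a \in H); first by exists H.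
have [p pH rK] := exists_leaf_point adM extM rM largeH.
have [sH _ _] := largeH.
have rH : matroid_rank (restrict M H) = n.+2.
  by apply: succn_inj; rewrite -(matroid_rank_restrict_hyperplane adM extM rM largeH).
have [|||G largeG pG] := IHn _ p (admissible_restrict H adM) _ _ rH.
- exact: extremal_restrict_hyperplane.
- by rewrite rH.
- by rewrite ground_restrict.
exists (G :|: (p |: (ground M :\: H))); first exact: large_hyperplaneU_leaf.
by rewrite in_setU in_setU1 in_setD aH aE !orbT.
Qed.

Theorem extremal_parallel_connections (T : finType) (l : nat) (M : matroid T) :
  admissible l M -> extremal l M -> 2 <= matroid_rank M ->
  parallel_connections_of (uniform 2 (l + 1)) M.
Proof.
move=> adM extM rM; have [n rME] : exists n, matroid_rank M = n.+2.
  by exists (matroid_rank M - 2); lia.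
elim: n M adM extM rM rME => [|n IHn] M adM extM rM rME.
  have [simpleM _ _] := adM; apply: PC_copy; rewrite addn1.
  by apply: simple_iso_uniform2; rewrite // ?rME // extM rME muln1 addn1.
have [a aE] : exists a, a \in ground M by apply/card_gt0P; rewrite extM addn1.
have [H largeH _] := exists_large_hyperplane adM extM rM aE.
have [p pH rK] := exists_leaf_point adM extM rM largeH; have [sH _ _] := largeH.
have rH : matroid_rank (restrict M H) = n.+2.
  by apply: succn_inj; rewrite -(matroid_rank_restrict_hyperplane adM extM rM largeH).
apply: PC_connect (leaf_parallel_connection adM extM rM largeH pH rK).
  exact/PC_copy/(leaf_uniform2 adM extM rM largeH pH rK).
apply: IHn => //; last by rewrite rH.
  exact: admissible_restrict.
exact: extremal_restrict_hyperplane.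
Qed.

Theorem theorem1p2 (R : realType) (r l : nat) (hr : 1 <= r) (hl : 1 <= l)
    (T : finType) (M : matroid T)
    (M_simple : simple_matroid M)
    (M_rank : matroid_rank M = r)
    (M_positroid : positroid R M)
    (M_no_minor : ~ has_minor M (uniform 2 (l + 2))) :
  #|ground M| <= l * (r - 1) + 1 /\
  (2 <= r ->
     (#|ground M| = l * (r - 1) + 1 <->
      parallel_connections_of (uniform 2 (l + 1)) M)).
Proof.
have adM : admissible l M by split=> //; apply: positroid_noncrossing M_positroid.
have bound := admissible_card_le adM; subst r; split=> // r2; split=> [extM|pcM].
  exact: extremal_parallel_connections.
by apply/eqP; rewrite eqn_leq bound; have [_ ->] := parallel_connections_card_ge pcM.
Qed.
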